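(* Let $m\geq 2$ and let $x_1,x_2,x_3$ be three distinct points of $\mathbb{S}^2$. Then $B_m(\mathbb{S}^2\setminus\{x_1,x_2,x_3\})$ is a semi-direct product $K_0\rtimes B_m(\mathbb{D}^2)$ of a group $K_0$ by $B_m(\mathbb{D}^2)$. In particular, for all $i\geq 1$, $(B_m(\mathbb{S}^2\setminus\{x_1,x_2,x_3\}))^{(i)}$ is a semi-direct product $K_i\rtimes(B_m(\mathbb{D}^2))^{(i)}$ of a group $K_i$ by $(B_m(\mathbb{D}^2))^{(i)}$.
   Context: For a surface $M$, $F_m(M)=\{(y_1,\ldots,y_m)\in M^m: y_i\neq y_j\text{ if }i\neq j\}$, and $B_m(M)=\pi_1(F_m(M)/S_m)$ is the $m$-string braid group of $M$. $\mathbb{D}^2$ is the closed $2$-disc, so that $B_m(\mathbb{D}^2)$ is Artin's $m$-string braid group. Derived series: $G^{(0)}=G$, $G^{(i)}=[G^{(i-1)},G^{(i-1)}]$. In $N\rtimes Q$ the normal subgroup is $N$. *)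

(* Defs.v *)
From HB Require Import structures.
From mathcomp Require Import all_boot all_order all_algebra all_fingroup.
From mathcomp Require Import generic_quotient.
From mathcomp Require Import all_classical all_reals.
From mathcomp Require Import topology normedtype homotopy.
From mathcomp Require Import lra.

Set Implicit Arguments.
Unset Strict Implicit.
Unset Printing Implicit Defensive.

Import Order.TTheory GRing.Theory Num.Theory.
Import numFieldNormedType.Exports.

Local Open Scope classical_set_scope.
Local Open Scope ring_scope.
Local Open Scope quotient_scope.

Section UnitInterval.
Variable R : realType.

Definition unit_interval : Type := set_type (`[0, 1]%classic : set R).
HB.instance Definition _ :=
  Topological.copy unit_interval (set_type (`[0, 1]%classic : set R)).

Definition clamp_val (r : R) : R := Num.max 0 (Num.min r 1).

Lemma clamp_subproof r : clamp_val r \in (`[0, 1]%classic : set R).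
Proof.
apply/mem_set; rewrite /= in_itv /= /clamp_val le_max lexx /= ge_max ler01 /=.
by rewrite ge_min lexx orbT.
Qed.

(* The retraction of R onto [0, 1]; it turns real formulas into points of the
   unit interval without carrying bounds. *)
Definition clamp (r : R) : unit_interval :=
  exist _ (clamp_val r) (clamp_subproof r).

Definition ival (t : unit_interval) : R := \val t.

Lemma ival_itv t : 0 <= ival t <= 1.
Proof. by have := set_mem (valP t); rewrite /= in_itv. Qed.

Lemma ival_clamp r : 0 <= r <= 1 -> ival (clamp r) = r.
Proof. by move=> /andP[r0 r1]; rewrite /ival /= /clamp_val min_l // max_r. Qed.

Lemma ival_inj : injective ival.
Proof. exact: val_inj. Qed.

Lemma ivalK t : clamp (ival t) = t.
Proof. by apply: ival_inj; rewrite ival_clamp // ival_itv. Qed.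

Lemma unit_interval_neq : clamp 0 != clamp 1.
Proof.
apply/eqP => /(congr1 ival); rewrite !ival_clamp ?lexx ?ler01 //.
by move/eqP; rewrite eq_sym oner_eq0.
Qed.

HB.instance Definition _ := isBiPointed.Build unit_interval unit_interval_neq.

Lemma clamp0 : clamp 0 = zero. Proof. by []. Qed.

Lemma clamp1 : clamp 1 = one. Proof. by []. Qed.

Lemma ival0 : ival zero = 0.
Proof. by rewrite ival_clamp // lexx ler01. Qed.

Lemma ival1 : ival one = 1.
Proof. by rewrite ival_clamp // lexx ler01. Qed.

Lemma continuous_ival : continuous ival.
Proof. exact: initial_continuous. Qed.

Lemma continuous_clamp : continuous clamp.
Proof.
apply/continuousP => A [B oB <-].
rewrite (_ : _ @^-1` _ = clamp_val @^-1` B) //.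
move: B oB; apply/continuousP => r.
apply: (@continuous_max R R (cst 0) (fun r => Num.min r 1)).
  exact: cst_continuous.
by apply: (@continuous_min R R id (cst 1)); [exact: id | exact: cst_continuous].
Qed.

End UnitInterval.
Arguments clamp {R}.
Arguments ival {R}.

Section PathAlgebra.
Variables (R : realType) (X : topologicalType).
Local Notation I := (unit_interval R).

Lemma paste_continuous (Y : topologicalType) (k : Y -> R) (c : R)
    (f g : Y -> X) :
  continuous k -> continuous f -> continuous g ->
  (forall y, k y = c -> f y = g y) ->
  continuous (fun y => if k y <= c then f y else g y).
Proof.
move=> ck cf cg fg y U /=.
case: (ltgtP (k y) c) => kyc nU.
- have kn : \forall z \near y, k z < c by exact: (ck y _ (lt_nbhsl kyc)).
  have fn : \forall z \near y, U (f z) by exact: (cf y _ nU).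
  by apply: filterS2 kn fn => z /= /ltW ->.
- have kn : \forall z \near y, c < k z by exact: (ck y _ (lt_nbhsr kyc)).
  have gn : \forall z \near y, U (g z) by exact: (cg y _ nU).
  by apply: filterS2 kn gn => z /=; rewrite ltNge => /negbTE ->.
- have fn : \forall z \near y, U (f z) by exact: (cf y _ nU).
  have gn : \forall z \near y, U (g z) by apply: (cg y U); rewrite -fg.
  by apply: filterS2 fn gn => z /= Uz Vz; case: ifP.
Qed.

Definition concat_fun (f g : I -> X) (t : I) : X :=
  if ival t <= 2^-1 then f (clamp (2 * ival t)) else g (clamp (2 * ival t - 1)).

Definition reverse_fun (f : I -> X) (t : I) : X := f (clamp (1 - ival t)).

Lemma continuous_clamp_comp (Y : topologicalType) (h : Y -> R) (f : I -> X) :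
  continuous h -> continuous f -> continuous (fun y => f (clamp (h y))).
Proof.
move=> ch cf y; apply: (@continuous_comp _ _ _ (clamp \o h) f); last exact: cf.
by apply: continuous_comp; [exact: ch | exact: continuous_clamp].
Qed.

Lemma continuous_affine (Y : topologicalType) (k : Y -> R) (a b : R) :
  continuous k -> continuous (fun y => a * k y + b).
Proof.
move=> ck y; apply: (@cvgD R R^o); last exact: cvg_cst.
by apply: cvgM; [exact: cvg_cst | exact: ck].
Qed.

Lemma continuous_fun_min (Y : topologicalType) (h k : Y -> R) :
  continuous h -> continuous k -> continuous (fun y => Num.min (h y) (k y)).
Proof.
by move=> ch ck y; apply: (@continuous_min R Y h k y); [exact: ch | exact: ck].
Qed.

Lemma continuous_fun_max (Y : topologicalType) (h k : Y -> R) :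
  continuous h -> continuous k -> continuous (fun y => Num.max (h y) (k y)).
Proof.
by move=> ch ck y; apply: (@continuous_max R Y h k y); [exact: ch | exact: ck].
Qed.

Section Concat.
Variables (x y z : X) (f : {path I from x to y in X}).
Variable (g : {path I from y to z in X}).

Lemma concat_continuous : continuous (concat_fun f g).
Proof.
apply: paste_continuous; first exact: continuous_ival.
- apply: continuous_clamp_comp; last exact: cts_fun.
  rewrite (_ : (fun y => _) = (fun y => 2 * ival y + 0)).
    by apply: continuous_affine; exact: continuous_ival.
  by apply/funext => t; rewrite addr0.
- apply: continuous_clamp_comp; last exact: cts_fun.
  by apply: continuous_affine; exact: continuous_ival.
move=> t ->; rewrite mulfV ?pnatr_eq0 // subrr.
by rewrite clamp1 clamp0 path_zero path_one.
Qed.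

Lemma concat_zero : concat_fun f g zero = x.
Proof.
by rewrite /concat_fun ival0 invr_ge0 ler0n mulr0 clamp0 path_zero.
Qed.

Lemma concat_one : concat_fun f g one = z.
Proof.
have e : (1 <= 2^-1 :> R) = false by apply/negbTE; rewrite -ltNge; lra.
have e1 : 2 * 1 - 1 = 1 :> R by lra.
by rewrite /concat_fun ival1 e e1 clamp1 path_one.
Qed.

HB.instance Definition _ :=
  isContinuous.Build I X (concat_fun f g) concat_continuous.
HB.instance Definition _ :=
  isPath.Build I X x z (concat_fun f g) concat_zero concat_one.

Definition concat : {path I from x to z in X} := concat_fun f g.

End Concat.

Section Reverse.
Variables (x y : X) (f : {path I from x to y in X}).

Lemma reverse_continuous : continuous (reverse_fun f).
Proof.
apply: continuous_clamp_comp; last exact: cts_fun.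
rewrite (_ : (fun y => _) = (fun y => -1 * ival y + 1)).
  by apply: continuous_affine; exact: continuous_ival.
by apply/funext => t; rewrite mulN1r addrC.
Qed.

Lemma reverse_zero : reverse_fun f zero = y.
Proof. by rewrite /reverse_fun ival0 subr0 clamp1 path_one. Qed.

Lemma reverse_one : reverse_fun f one = x.
Proof. by rewrite /reverse_fun ival1 subrr clamp0 path_zero. Qed.

HB.instance Definition _ :=
  isContinuous.Build I X (reverse_fun f) reverse_continuous.
HB.instance Definition _ :=
  isPath.Build I X y x (reverse_fun f) reverse_zero reverse_one.

Definition reverse : {path I from y to x in X} := reverse_fun f.

End Reverse.

Definition const_path (x : X) : {path I from x to x in X} := cst x.

(* Homotopy relative to the endpoints. *)
Definition path_homotopic (x y : X) (f g : {path I from x to y in X}) : Prop :=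
  exists H : I * I -> X,
    [/\ continuous H,
        forall t, H (t, zero) = f t,
        forall t, H (t, one) = g t,
        forall s, H (zero, s) = x &
        forall s, H (one, s) = y].

Section Homotopic.
Variables x y : X.
Implicit Types f g h : {path I from x to y in X}.

Lemma path_homotopic_refl f : path_homotopic f f.
Proof.
exists (f \o fst); split=> //= [|s|s]; last 2 first.
- exact: path_zero.
- exact: path_one.
by move=> p; apply: continuous_comp; [exact: cvg_fst | exact: cts_fun].
Qed.

Lemma continuous_pair (A B C : topologicalType) (u : A -> B) (v : A -> C) :
  continuous u -> continuous v -> continuous (fun a => (u a, v a)).
Proof. by move=> cu cv a; apply: cvg_pair; [exact: cu | exact: cv]. Qed.

Lemma continuous_second (h : R -> R) : continuous h ->
  continuous (fun p : I * I => (p.1, clamp (h (ival p.2)) : I)).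
Proof.
move=> ch; apply: continuous_pair; first by move=> p; exact: cvg_fst.
move=> p; apply: (@continuous_comp _ _ _ (h \o ival \o snd) clamp).
  apply: (@continuous_comp _ _ _ (ival \o snd) h); last exact: ch.
  by apply: continuous_comp; [exact: cvg_snd | exact: continuous_ival].
exact: continuous_clamp.
Qed.

Lemma path_homotopic_sym f g : path_homotopic f g -> path_homotopic g f.
Proof.
move=> [H [cH Hf Hg Hx Hy]].
exists (H \o (fun p : I * I => (p.1, clamp (1 - ival p.2) : I))).
split=> [|t|t|s|s] /=; rewrite ?ival0 ?ival1 ?subr0 ?subrr //.
move=> p; apply: continuous_comp; last exact: cH.
apply: (@continuous_second (fun r => 1 - r)) => r.
by apply: cvgB; [exact: cvg_cst | exact: cvg_id].
Qed.

Lemma path_homotopic_trans f g h :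
  path_homotopic f g -> path_homotopic g h -> path_homotopic f h.
Proof.
move=> [H [cH Hf Hg Hx Hy]] [K [cK Kg Kh Kx Ky]].
exists (fun p : I * I => if ival p.2 <= 2^-1 then H (p.1, clamp (2 * ival p.2))
                    else K (p.1, clamp (2 * ival p.2 - 1))).
split=> [|t|t|s|s] /=; rewrite ?ival0 ?ival1.
- apply: (@paste_continuous _ (fun p : I * I => ival p.2)).
  + by move=> p; apply: continuous_comp; [exact: cvg_snd|exact: continuous_ival].
  + move=> p; apply: continuous_comp; last exact: cH.
    apply: (@continuous_second (fun r => 2 * r)) => r.
    by apply: cvgM; [exact: cvg_cst | exact: cvg_id].
  + move=> p; apply: continuous_comp; last exact: cK.
    apply: (@continuous_second (fun r => 2 * r - 1)) => r.
    by apply: (@continuous_affine _ id) => ?; exact: cvg_id.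
  + move=> [t s] /= ->; rewrite mulfV ?pnatr_eq0 // subrr.
    by rewrite clamp1 clamp0 Hg Kg.
- by rewrite invr_ge0 ler0n mulr0 clamp0 Hf.
- have e : (1 <= 2^-1 :> R) = false by apply/negbTE; rewrite -ltNge; lra.
  have e1 : 2 * 1 - 1 = 1 :> R by lra.
  by rewrite e e1 clamp1 Kh.
- by case: ifP.
- by case: ifP.
Qed.

End Homotopic.

(* Two reparametrizations of a path agreeing at the endpoints are homotopic, by
   the straight-line homotopy in the unit interval. *)
Lemma path_homotopic_reparam (a b x y : X) (f : {path I from a to b in X})
    (p q : {path I from x to y in X}) (u v : I -> R) :
  continuous u -> continuous v ->
  u zero = v zero -> u one = v one ->
  (forall t, p t = f (clamp (u t))) -> (forall t, q t = f (clamp (v t))) ->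
  path_homotopic p q.
Proof.
move=> cu cv uv0 uv1 pE qE.
exists (fun w : I * I =>
  f (clamp ((1 - ival w.2) * u w.1 + ival w.2 * v w.1))).
split=> [|t|t|s|s] /=; rewrite ?ival0 ?ival1.
- apply: continuous_clamp_comp; last exact: cts_fun.
  have c2 : continuous (fun w : I * I => ival w.2).
    by move=> w; apply: continuous_comp; [exact: cvg_snd|exact: continuous_ival].
  have cu1 : continuous (fun w : I * I => u w.1).
    by move=> w; apply: continuous_comp; [exact: cvg_fst|exact: cu].
  have cv1 : continuous (fun w : I * I => v w.1).
    by move=> w; apply: continuous_comp; [exact: cvg_fst|exact: cv].
  move=> w; apply: (@cvgD R R^o).
    apply: cvgM; last exact: cu1.
    by apply: (@cvgB R R^o); [exact: cvg_cst | exact: c2].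
  by apply: cvgM; [exact: c2 | exact: cv1].
- by rewrite pE subr0 mul1r mul0r addr0.
- by rewrite qE subrr mul0r mul1r add0r.
- rewrite -uv0 -mulrDl subrK mul1r -pE; exact: path_zero.
- rewrite -uv1 -mulrDl subrK mul1r -pE; exact: path_one.
Qed.

Lemma path_homotopic_concat (x y z : X)
    (f f' : {path I from x to y in X}) (g g' : {path I from y to z in X}) :
  path_homotopic f f' -> path_homotopic g g' ->
  path_homotopic (concat f g) (concat f' g').
Proof.
move=> [H [cH Hf Hf' Hx Hy]] [K [cK Kg Kg' Ky Kz]].
exists (fun p : I * I => if ival p.1 <= 2^-1 then H (clamp (2 * ival p.1), p.2)
                    else K (clamp (2 * ival p.1 - 1), p.2)).
have c1 : continuous (fun w : I * I => ival w.1).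
  by move=> w; apply: continuous_comp; [exact: cvg_fst|exact: continuous_ival].
have cl (a b : R) : continuous
    (fun w : I * I => (clamp (a * ival w.1 + b) : I, w.2)).
  apply: continuous_pair; last by move=> p; exact: cvg_snd.
  move=> p; apply: (@continuous_comp _ _ _ (fun w : I * I => a * ival w.1 + b)).
    exact: continuous_affine.
  exact: continuous_clamp.
split=> [|t|t|s|s] /=; rewrite ?ival0 ?ival1.
- apply: (@paste_continuous _ (fun p : I * I => ival p.1)) => //.
  + move=> p; apply: continuous_comp; last exact: cH.
    have := cl 2 0; rewrite (_ : (fun w : I * I => (clamp (2 * ival w.1 + 0) : I, w.2))
      = (fun w => (clamp (2 * ival w.1), w.2))); first by apply.
    by apply/funext => w; rewrite addr0.
  + by move=> p; apply: continuous_comp; [exact: cl | exact: cK].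
  + move=> [t s] /= ->; rewrite mulfV ?pnatr_eq0 // subrr.
    by rewrite clamp1 clamp0 Hy Ky.
- by rewrite Hf Kg.
- by rewrite Hf' Kg'.
- by rewrite invr_ge0 ler0n mulr0 clamp0.
- have e : (1 <= 2^-1 :> R) = false by apply/negbTE; rewrite -ltNge; lra.
  have e1 : 2 * 1 - 1 = 1 :> R by lra.
  by rewrite e e1 clamp1 Kz.
Qed.

Lemma path_homotopic_reverse (x y : X) (f g : {path I from x to y in X}) :
  path_homotopic f g -> path_homotopic (reverse f) (reverse g).
Proof.
move=> [H [cH Hf Hg Hx Hy]].
exists (fun p : I * I => H (clamp (1 - ival p.1), p.2)).
split=> [|t|t|s|s] /=; rewrite ?ival0 ?ival1 ?subr0 ?subrr ?Hf ?Hg ?clamp1 ?clamp0 //.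
move=> p; apply: (@continuous_comp _ _ _
  (fun w : I * I => (clamp (1 - ival w.1) : I, w.2)) H); last exact: cH.
apply: continuous_pair; last by move=> w; exact: cvg_snd.
move=> w; apply: (@continuous_comp _ _ _ (fun w : I * I => 1 - ival w.1)).
  apply: (@cvgB R R^o); first exact: cvg_cst.
  by apply: continuous_comp; [exact: cvg_fst|exact: continuous_ival].
exact: continuous_clamp.
Qed.

Lemma path_homotopic_concatA (x y z w : X) (f : {path I from x to y in X})
    (g : {path I from y to z in X}) (h : {path I from z to w in X}) :
  path_homotopic (concat (concat f g) h) (concat f (concat g h)).
Proof.
pose u (t : I) : R := Num.min (2 * ival t + 0)
  (Num.min (1 * ival t + 4^-1) (2^-1 * ival t + 2^-1)).
apply: (@path_homotopic_reparam _ _ _ _ (concat f (concat g h)) _ _ u ival).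
- by do 2?[apply: continuous_fun_min]; apply: continuous_affine;
    exact: continuous_ival.
- exact: continuous_ival.
- by rewrite /u ival0 /Order.min; do ![case: ifP => //]; lra.
- by rewrite /u ival1 /Order.min; do ![case: ifP => //]; lra.
- move=> t; rewrite /concat /= /concat_fun.
  have /andP[t0 t1] := ival_itv t.
  have u01 : 0 <= u t <= 1.
    by rewrite /u /Order.min; do ![case: ifP]; lra.
  rewrite (ival_clamp u01).
  case: (leP (ival t) 2^-1) => t2.
    rewrite ival_clamp; last by lra.
    case: (leP (2 * ival t) 2^-1) => t4.
      have -> : u t = 2 * ival t.
        by rewrite /u /Order.min; do ![case: ifP]; lra.
      by rewrite ifT //; lra.
    have uE : u t = ival t + 4^-1.
      by rewrite /u /Order.min; do ![case: ifP]; lra.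
    rewrite uE ifF; last by apply/negbTE; rewrite -ltNge; lra.
    rewrite ival_clamp; last by lra.
    rewrite ifT; last by lra.
    by congr (g (clamp _)); lra.
  have uE : u t = 2^-1 * ival t + 2^-1.
    by rewrite /u /Order.min; do ![case: ifP]; lra.
  rewrite uE ifF; last by apply/negbTE; rewrite -ltNge; lra.
  rewrite ival_clamp; last by lra.
  rewrite ifF; last by apply/negbTE; rewrite -ltNge; lra.
  by congr (h (clamp _)); lra.
- by move=> t; rewrite ivalK.
Qed.

Lemma path_homotopic_concat1p (x y : X) (f : {path I from x to y in X}) :
  path_homotopic (concat (const_path x) f) f.
Proof.
pose u (t : I) : R := Num.max 0 (2 * ival t + (-1)).
apply: (@path_homotopic_reparam _ _ _ _ f _ _ u ival).
- apply: continuous_fun_max; first exact: cst_continuous.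
  by apply: continuous_affine; exact: continuous_ival.
- exact: continuous_ival.
- by rewrite /u ival0 /Order.max; case: ifP; lra.
- by rewrite /u ival1 /Order.max; case: ifP; lra.
- move=> t; rewrite /concat /= /concat_fun /u.
  case: (leP (ival t) 2^-1) => t2.
    rewrite max_l; last by lra.
    by rewrite clamp0 path_zero.
  by rewrite max_r //; lra.
- by move=> t; rewrite ivalK.
Qed.

Lemma path_homotopic_concatp1 (x y : X) (f : {path I from x to y in X}) :
  path_homotopic (concat f (const_path y)) f.
Proof.
pose u (t : I) : R := Num.min (2 * ival t + 0) 1.
apply: (@path_homotopic_reparam _ _ _ _ f _ _ u ival).
- apply: continuous_fun_min; last exact: cst_continuous.
  by apply: continuous_affine; exact: continuous_ival.
- exact: continuous_ival.
- by rewrite /u ival0 /Order.min; case: ifP; lra.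
- by rewrite /u ival1 /Order.min; case: ifP; lra.
- move=> t; rewrite /concat /= /concat_fun /u addr0.
  case: (leP (ival t) 2^-1) => t2.
    by rewrite min_l //; lra.
  rewrite min_r; last by lra.
  by rewrite clamp1 path_one.
- by move=> t; rewrite ivalK.
Qed.

Lemma path_homotopic_concatpV (x y : X) (f : {path I from x to y in X}) :
  path_homotopic (concat f (reverse f)) (const_path x).
Proof.
pose u (t : I) : R := Num.min (2 * ival t + 0) ((-2) * ival t + 2).
apply: (@path_homotopic_reparam _ _ _ _ f _ _ u (cst 0)).
- by apply: continuous_fun_min; apply: continuous_affine;
    exact: continuous_ival.
- exact: cst_continuous.
- by rewrite /u ival0 /cst /Order.min; case: ifP; lra.
- by rewrite /u ival1 /cst /Order.min; case: ifP; lra.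
- move=> t; rewrite /concat /= /concat_fun /u addr0.
  have /andP[t0 t1] := ival_itv t.
  case: (leP (ival t) 2^-1) => t2.
    by rewrite min_l //; lra.
  rewrite min_r; last by lra.
  rewrite /reverse /= /reverse_fun ival_clamp; last by lra.
  by congr (f (clamp _)); lra.
- by move=> t; rewrite /= clamp0 path_zero.
Qed.

Lemma reverseK (x y : X) (f : {path I from x to y in X}) :
  reverse (reverse f) = f.
Proof.
apply/path_eqP => t; rewrite /reverse /= /reverse_fun.
have /andP[t0 t1] := ival_itv t.
rewrite ival_clamp; last by lra.
by rewrite opprB addrC subrK ivalK.
Qed.

Lemma path_homotopic_concatVp (x y : X) (f : {path I from x to y in X}) :
  path_homotopic (concat (reverse f) f) (const_path y).
Proof. by rewrite -{2}(reverseK f); exact: path_homotopic_concatpV. Qed.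

End PathAlgebra.

Section FundamentalGroup.
Variables (R : realType) (X : topologicalType) (x : X).
Local Notation loop := {path (unit_interval R) from x to x in X}.

Definition loop_rel (f g : loop) : bool := `[< path_homotopic f g >].

Lemma loop_rel_refl : reflexive loop_rel.
Proof. by move=> f; apply/asboolP; exact: path_homotopic_refl. Qed.

Lemma loop_rel_sym : symmetric loop_rel.
Proof.
by move=> f g; apply/asboolP/asboolP => /path_homotopic_sym.
Qed.

Lemma loop_rel_trans : transitive loop_rel.
Proof.
move=> g f h /asboolP fg /asboolP gh; apply/asboolP.
exact: path_homotopic_trans fg gh.
Qed.

Canonical loop_equiv :=
  EquivRel loop_rel loop_rel_refl loop_rel_sym loop_rel_trans.

Definition pi1 : Type := {eq_quot loop_equiv}.
HB.instance Definition _ := Choice.copy pi1 {eq_quot loop_equiv}.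
HB.instance Definition _ := Quotient.copy pi1 {eq_quot loop_equiv}.

Lemma pi1_eqP (f g : loop) : \pi_pi1 f = \pi_pi1 g <-> path_homotopic f g.
Proof.
by split=> [/eqmodP/asboolP //|fg]; apply/eqmodP; exact/asboolP.
Qed.

Definition pi1_mul (a b : pi1) : pi1 := \pi_pi1 (concat (repr a) (repr b)).
Definition pi1_one : pi1 := \pi_pi1 (const_path R x).
Definition pi1_inv (a : pi1) : pi1 := \pi_pi1 (reverse (repr a)).

Lemma pi1_mulE f g : pi1_mul (\pi_pi1 f) (\pi_pi1 g) = \pi_pi1 (concat f g).
Proof.
by apply/pi1_eqP; apply: path_homotopic_concat; apply/pi1_eqP; rewrite reprK.
Qed.

Lemma pi1_invE f : pi1_inv (\pi_pi1 f) = \pi_pi1 (reverse f).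
Proof.
by apply/pi1_eqP; apply: path_homotopic_reverse; apply/pi1_eqP; rewrite reprK.
Qed.

Lemma pi1_mulA : associative pi1_mul.
Proof.
move=> a b c; rewrite -(reprK a) -(reprK b) -(reprK c).
rewrite (pi1_mulE (repr a) (repr b)) (pi1_mulE (repr b)) !pi1_mulE.
by apply/esym/pi1_eqP; exact: path_homotopic_concatA.
Qed.

Lemma pi1_mul1 : left_id pi1_one pi1_mul.
Proof.
move=> a; rewrite -(reprK a) pi1_mulE.
by apply/pi1_eqP; exact: path_homotopic_concat1p.
Qed.

Lemma pi1_mulr1 : right_id pi1_one pi1_mul.
Proof.
move=> a; rewrite -(reprK a) pi1_mulE.
by apply/pi1_eqP; exact: path_homotopic_concatp1.
Qed.

Lemma pi1_mulV : left_inverse pi1_one pi1_inv pi1_mul.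
Proof.
move=> a; rewrite -(reprK a) pi1_invE pi1_mulE.
by apply/pi1_eqP; exact: path_homotopic_concatVp.
Qed.

Lemma pi1_mulrV : right_inverse pi1_one pi1_inv pi1_mul.
Proof.
move=> a; rewrite -(reprK a) pi1_invE pi1_mulE.
by apply/pi1_eqP; exact: path_homotopic_concatpV.
Qed.

HB.instance Definition _ :=
  isGroup.Build pi1 pi1_mulA pi1_mul1 pi1_mulr1 pi1_mulV pi1_mulrV.

End FundamentalGroup.
Arguments pi1 R {X} x.

Section ConfigurationSpaces.
Variables (m : nat) (M : topologicalType).

(* The subspace F_m(M) of M^m. *)
Definition config : topologicalType :=
  set_type [set y : prod_topology (fun _ : 'I_m => M) | injective y].

Definition config_rel (y z : config) : bool :=
  `[< exists s : 'S_m, forall i, \val z i = \val y (s i) >].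

Lemma config_rel_refl : reflexive config_rel.
Proof. by move=> y; apply/asboolP; exists 1%g => i; rewrite perm1. Qed.

Lemma config_rel_sym : symmetric config_rel.
Proof.
by move=> y z; apply/asboolP/asboolP => -[s sE]; exists s^-1%g => i;
  rewrite sE permKV.
Qed.

Lemma config_rel_trans : transitive config_rel.
Proof.
move=> z y w /asboolP[s sE] /asboolP[t tE]; apply/asboolP.
by exists (t * s)%g => i; rewrite tE sE permM.
Qed.

Canonical config_equiv :=
  EquivRel config_rel config_rel_refl config_rel_sym config_rel_trans.

(* The orbit space F_m(M) / S_m. *)
Definition uconfig : topologicalType :=
  quotient_topology {eq_quot config_equiv}.

End ConfigurationSpaces.

(* The group B_m(M), with its base point made explicit: c is an unordered
   configuration of m points of M. *)
Definition braid_group (R : realType) (m : nat) (M : topologicalType)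
  (c : uconfig m M) : groupType := pi1 R c.

Definition sphere2 (R : realType) : set 'rV[R]_3 :=
  [set v | \sum_i v 0 i ^+ 2 = 1].
Arguments sphere2 R : clear implicits.

Definition disc2 (R : realType) : set 'rV[R]_2 :=
  [set v | \sum_i v 0 i ^+ 2 <= 1].
Arguments disc2 R : clear implicits.

Section DerivedSeries.
Local Open Scope group_scope.

Definition commutators (G : groupType) : set G :=
  [set g | exists a b : G, g = [~ a, b]].
Arguments commutators G : clear implicits.

Definition commutator_set (G : groupType) : set G :=
  smallest (fun H : set G => group_closed (mem H)) (commutators G).
Arguments commutator_set G : clear implicits.

Lemma commutator_set_closed (G : groupType) :
  group_closed (mem (commutator_set G)).
Proof.
split=> [|a b /set_mem aG /set_mem bG].
  by apply/mem_set => H [[H1 _] _]; apply/set_mem.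
by apply/mem_set => H [HG HC]; apply/set_mem/(proj2 HG); apply/mem_set;
  [exact: aG | exact: bG].
Qed.

Definition commutator_subgroup (G : groupType) : Type :=
  {g : G | g \in commutator_set G}.

Section Instances.
Variable G : groupType.
HB.instance Definition _ := SubChoice.copy (commutator_subgroup G)
  {g : G | g \in commutator_set G}.
HB.instance Definition _ := SubChoice_isSubGroup.Build G
  (fun g => g \in commutator_set G) (commutator_subgroup G)
  (commutator_set_closed G).
End Instances.

(* The i-th term G^(i) of the derived series, as a group in its own right. *)
Fixpoint derived (i : nat) (G : groupType) : groupType :=
  if i is j.+1 then commutator_subgroup (derived j G) else G.

End DerivedSeries.

Section SemidirectProduct.
Local Open Scope group_scope.
Variables (K Q : groupType).

(* A left action of Q on K by automorphisms, i.e. a morphism from Q to Aut K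
   (each aut_act q is invertible with inverse aut_act q^-1). *)
Record aut_action := AutAction {
  aut_act :> Q -> K -> K;
  aut_actM : forall q k k', aut_act q (k * k') = aut_act q k * aut_act q k';
  aut_act1 : forall k, aut_act 1 k = k;
  aut_actMl : forall q q' k, aut_act (q * q') k = aut_act q (aut_act q' k)
}.

Definition semidirect (phi : aut_action) : Type := (K * Q)%type.

Section Instance.
Variable phi : aut_action.
Local Notation S := (semidirect phi).
HB.instance Definition _ := Choice.copy S (K * Q)%type.

Definition semidirect_mul (a b : S) : S := (a.1 * phi a.2 b.1, a.2 * b.2).
Definition semidirect_one : S := (1, 1).
Definition semidirect_inv (a : S) : S := (phi a.2^-1 a.1^-1, a.2^-1).

Lemma aut_act_one q : phi q 1 = 1.
Proof.
by apply: (mulgI (phi q 1)); rewrite -aut_actM !mulg1.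
Qed.

Lemma semidirect_mulA : associative semidirect_mul.
Proof.
by move=> a b c; rewrite /semidirect_mul /= aut_actM aut_actMl !mulgA.
Qed.

Lemma semidirect_mul1 : left_id semidirect_one semidirect_mul.
Proof. by move=> [k q]; rewrite /semidirect_mul /= aut_act1 !mul1g. Qed.

Lemma semidirect_mulr1 : right_id semidirect_one semidirect_mul.
Proof. by move=> [k q]; rewrite /semidirect_mul /= aut_act_one !mulg1. Qed.

Lemma semidirect_mulV :
  left_inverse semidirect_one semidirect_inv semidirect_mul.
Proof.
by move=> [k q]; rewrite /semidirect_mul /= -aut_actM !mulVg aut_act_one.
Qed.

Lemma semidirect_mulrV :
  right_inverse semidirect_one semidirect_inv semidirect_mul.
Proof.
by move=> [k q]; rewrite /semidirect_mul /= -aut_actMl !mulgV aut_act1 mulgV.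
Qed.

HB.instance Definition _ := isGroup.Build S semidirect_mulA semidirect_mul1
  semidirect_mulr1 semidirect_mulV semidirect_mulrV.

End Instance.
End SemidirectProduct.

Definition group_iso (G H : groupType) : Prop :=
  exists f : {multiplicative G -> H}, bijective f.

(* G is a semi-direct product of some group K by Q, with K as the normal
   factor. *)
Definition is_semidirect_by (G Q : groupType) : Prop :=
  exists (K : groupType) (phi : aut_action K Q), group_iso G (semidirect phi).

(* Main.v *)
(* Stereographic projection from [x1] followed by a radial squeeze embeds the
   punctured sphere in the disc, a far translate of the disc embeds in the
   punctured sphere, and the composite self-embedding of the disc is isotopic to
   the identity. So the braid group of the disc is a retract of that of the
   punctured sphere: there is a homomorphism onto it with a section, which gives
   the semidirect product. Functors preserve retracts, in particular the terms of
   the derived series do.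

   As the base points are arbitrary, one also needs a path from [b] to the image
   of [d]. Choose a linear form [height] that separates all the points involved.
   Along its level lines the points of [b] move past the punctures without
   meeting them or each other; then they join those of [d] by straight lines, the
   two configurations being numbered by increasing height. *)

Require Import Defs.
From HB Require Import structures.
From mathcomp Require Import all_boot all_order all_algebra all_fingroup.
From mathcomp Require Import generic_quotient.
From mathcomp Require Import all_classical all_reals.
From mathcomp Require Import topology normedtype homotopy realfun.
From mathcomp Require Import ring lra.

Set Implicit Arguments.
Unset Strict Implicit.
Unset Printing Implicit Defensive.

Import Order.TTheory GRing.Theory Num.Theory.
Import numFieldNormedType.Exports.

Local Open Scope classical_set_scope.
Local Open Scope ring_scope.
Local Open Scope quotient_scope.

(** * Retracts and semidirect products *)

Section Retracts.
Local Open Scope group_scope.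

Definition group_retract (Q G : groupType) : Prop :=
  exists (s : Q -> G) (p : G -> Q),
    [/\ {morph s : x y / x * y}, {morph p : x y / x * y} & cancel s p].

Section Morphism.
Variables (G H : groupType) (f : G -> H).
Hypothesis fM : {morph f : x y / x * y}.

Lemma morph1 : f 1 = 1.
Proof. by apply: (mulgI (f 1)); rewrite -fM !mulg1. Qed.

Lemma morphV : {morph f : x / x^-1}.
Proof. by move=> x; apply: (mulgI (f x)); rewrite -fM !mulgV morph1. Qed.

Lemma morphR : {morph f : x y / [~ x, y]}.
Proof. by move=> x y; rewrite /commg /conjg !(fM, morphV). Qed.

(* The proof that [f] is a morphism is an argument only so that the group
   structure can be inferred from the type. *)
Definition kernel_subgroup of {morph f : x y / x * y} : Type :=
  {x : G | f x == 1}.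

Lemma kernel_closed : group_closed (fun x => f x == 1).
Proof.
split=> [|x y]; first by apply/eqP/morph1.
rewrite !unfold_in => /eqP fx /eqP fy.
by rewrite fM morphV fx fy mulgV.
Qed.

HB.instance Definition _ :=
  SubChoice.copy (kernel_subgroup fM) {x : G | f x == 1}.
HB.instance Definition _ :=
  SubChoice_isSubGroup.Build G (fun x => f x == 1) (kernel_subgroup fM)
    kernel_closed.

(** For every subgroup [A] of [H] containing the commutators, the preimage of [A] under [f] is a
    subgroup of [G] containing the commutators, hence contains [commutator_set]. *)
Lemma commutator_set_morph x :
  x \in @commutator_set G -> f x \in @commutator_set H.
Proof.
move=> /set_mem xG; apply/mem_set => A [[A1 AF] AC].
apply: set_mem; apply: (xG (fun y => f y \in A)); split=> [|_ [a [b ->]]].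
  split=> [|y z /set_mem yA /set_mem zA].
    by apply/mem_set; rewrite morph1.
  by apply/mem_set; rewrite /= fM morphV; exact: AF.
rewrite morphR; apply/mem_set/AC; by exists (f a), (f b).
Qed.

Definition commutator_map (x : commutator_subgroup G) : commutator_subgroup H :=
  exist _ (f (val x)) (commutator_set_morph (valP x)).

Lemma commutator_mapM : {morph commutator_map : x y / x * y}.
Proof. by move=> x y; apply: val_inj; exact: fM. Qed.

End Morphism.

(** Section and retraction both restrict to the commutator subgroups, and the restrictions still
    compose to the identity. Iterating this carries the splitting down the derived series. *)
Lemma retract_commutator (Q G : groupType) :
  group_retract Q G ->
  group_retract (commutator_subgroup Q) (commutator_subgroup G).
Proof.
move=> [s [p [sM pM sK]]]; exists (commutator_map sM), (commutator_map pM).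
split; [exact: commutator_mapM | exact: commutator_mapM |].
by move=> x; apply: val_inj; rewrite /= sK.
Qed.

Lemma retract_derived (Q G : groupType) i :
  group_retract Q G -> group_retract (derived i Q) (derived i G).
Proof. by move=> QG; elim: i => //= i; exact: retract_commutator. Qed.

(** The normal factor is the kernel of [p], on which [q] acts by conjugation by [s q]. Every [g]
    splits as [g * (s (p g))^-1], which lies in the kernel, times [s (p g)]. *)
Lemma retract_semidirect (Q G : groupType) :
  group_retract Q G -> is_semidirect_by G Q.
Proof.
move=> [s [p [sM pM sK]]].
have kerJ q (k : kernel_subgroup pM) : p (s q * val k * (s q)^-1) == 1.
  by rewrite !pM (eqP (valP k)) mulg1 -pM mulgV morph1.
pose act q k : kernel_subgroup pM := exist (fun x => p x == 1) _ (kerJ q k).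
have actM q k k' : act q (k * k') = act q k * act q k'.
  by apply: val_inj; rewrite /= !(valM, mulgA) mulgKV.
have act1 k : act 1 k = k.
  by apply: val_inj; rewrite /= (morph1 sM) mul1g invg1 mulg1.
have actMl q q' k : act (q * q') k = act q (act q' k).
  by apply: val_inj; rewrite /= sM invgM !mulgA.
have kerD g : p (g * (s (p g))^-1) == 1.
  by rewrite pM (morphV pM) sK mulgV.
exists (kernel_subgroup pM), (AutAction actM act1 actMl).
pose F (g : G) : semidirect (AutAction actM act1 actMl) :=
  (exist (fun x => p x == 1) _ (kerD g), p g).
have FM : {morph F : x y / x * y}.
  move=> x y; congr pair; last exact: pM.
  apply: val_inj; rewrite /= pM sM invgM.
  (* The product of the semidirect group is unfolded by conversion, which displays the factors
     [(s (p x))^-1] and [s (p x)] that cancel. *)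
  by apply/esym; rewrite -[LHS]/(x * (s (p x))^-1 *
    (s (p x) * (y * (s (p y))^-1) * (s (p x))^-1)) !mulgA mulgKV.
pose FMixin := isMultiplicative.Build _ _ F FM.
exists (HB.pack_for {multiplicative G -> _} F FMixin) => /=.
exists (fun a => val a.1 * s a.2) => [x|[k q]]; first by rewrite /= mulgKV.
have pk : p (val k * s q) = q by rewrite pM (eqP (valP k)) mul1g sK.
by congr pair => //; apply: val_inj; rewrite /= pk mulgK.
Qed.

End Retracts.

(** * Homotopies of paths and induced maps of fundamental groups *)

Section PathHomotopy.
Variables (R : realType) (X : topologicalType).
Local Notation I := (unit_interval R).

Lemma clamp_le0 (r : R) : r <= 0 -> clamp r = zero.
Proof.
move=> r0; apply: ival_inj; rewrite ival0 /ival /= /clamp_val min_l ?max_l //.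
exact: le_trans r0 ler01.
Qed.

Lemma clamp_ge1 (r : R) : 1 <= r -> clamp r = one.
Proof.
by move=> r1; apply: ival_inj; rewrite ival1 /ival /= /clamp_val min_r ?max_r.
Qed.

(** The square is convex: [mix] interpolates between [u] and [v] in each coordinate, and [H] carries
    the interpolation to [X]. *)
Lemma path_homotopic_square (x y : X) (p q : {path I from x to y in X})
    (H : I * I -> X) (u v : I -> I * I) :
  continuous H -> continuous u -> continuous v ->
  u zero = v zero -> u one = v one ->
  (forall t, p t = H (u t)) -> (forall t, q t = H (v t)) ->
  path_homotopic p q.
Proof.
move=> cH cu cv uv0 uv1 pE qE.
pose mix (a b s : I) : I := clamp ((1 - ival s) * ival a + ival s * ival b).
have mix0 a b : mix a b zero = a.
  by rewrite /mix ival0 subr0 mul1r mul0r addr0 ivalK.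
have mix1 a b : mix a b one = b.
  by rewrite /mix ival1 subrr mul0r mul1r add0r ivalK.
have mixx a s : mix a a s = a by rewrite /mix -mulrDl subrK mul1r ivalK.
have cmix (a b : I * I -> I) : continuous a -> continuous b ->
    continuous (fun w => mix (a w) (b w) w.2).
  have ci (c : I * I -> I) : continuous c -> continuous (fun w => ival (c w)).
    by move=> cc w; apply: continuous_comp; [exact: cc|exact: continuous_ival].
  move=> ca cb w.
  apply: (@continuous_comp _ _ _
    (fun w : I * I => (1 - ival w.2) * ival (a w) + ival w.2 * ival (b w))
    clamp); last exact: continuous_clamp.
  have c2 : continuous (fun w : I * I => ival w.2).
    by apply: ci => ?; exact: cvg_snd.
  apply: (@cvgD R R^o).
    apply: cvgM; last exact: ci.
    by apply: (@cvgB R R^o); [exact: cvg_cst | exact: c2].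
  by apply: cvgM; [exact: c2 | exact: ci].
have cpr (w : I -> I * I) : continuous w ->
    continuous (fun z : I * I => (w z.1).1) /\
    continuous (fun z : I * I => (w z.1).2).
  move=> cw; have c1 : continuous (fun z : I * I => w z.1).
    by move=> z; apply: continuous_comp; [exact: cvg_fst | exact: cw].
  by split=> z; (apply: continuous_comp; first exact: c1);
    [exact: cvg_fst | exact: cvg_snd].
have [cu1 cu2] := cpr _ cu; have [cv1 cv2] := cpr _ cv.
exists (fun w : I * I => H (mix (u w.1).1 (v w.1).1 w.2,
                            mix (u w.1).2 (v w.1).2 w.2)).
split=> [|t|t|s|s] /=.
- move=> w; apply: (@continuous_comp _ _ _
    (fun w : I * I => (mix (u w.1).1 (v w.1).1 w.2,
                       mix (u w.1).2 (v w.1).2 w.2)) H); last exact: cH.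
  by apply: continuous_pair; apply: cmix.
- by rewrite !mix0 -surjective_pairing -pE.
- by rewrite !mix1 -surjective_pairing -qE.
- by rewrite -uv0 !mixx -surjective_pairing -pE path_zero.
- by rewrite -uv1 !mixx -surjective_pairing -pE path_one.
Qed.

Lemma path_homotopic_concatl (x y z : X) (f f' : {path I from x to y in X})
    (g : {path I from y to z in X}) :
  path_homotopic f f' -> path_homotopic (concat f g) (concat f' g).
Proof.
by move/path_homotopic_concat; apply; exact: path_homotopic_refl.
Qed.

Lemma path_homotopic_concatr (x y z : X) (f : {path I from x to y in X})
    (g g' : {path I from y to z in X}) :
  path_homotopic g g' -> path_homotopic (concat f g) (concat f g').
Proof. exact/path_homotopic_concat/path_homotopic_refl. Qed.

Lemma path_homotopic_concatK (x y z : X) (f : {path I from x to y in X})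
    (g : {path I from x to z in X}) :
  path_homotopic (concat f (concat (reverse f) g)) g.
Proof.
apply: path_homotopic_trans; first exact/path_homotopic_sym/path_homotopic_concatA.
apply: path_homotopic_trans (path_homotopic_concat1p g).
apply: path_homotopic_concatl; exact: path_homotopic_concatpV.
Qed.

Lemma path_homotopic_concatVK (x y z : X) (f : {path I from x to y in X})
    (g : {path I from y to z in X}) :
  path_homotopic (concat (reverse f) (concat f g)) g.
Proof. by rewrite -{2}(reverseK f); exact: path_homotopic_concatK. Qed.

End PathHomotopy.

Section ChangeOfBasePoint.
Variables (R : realType) (X : topologicalType).
Local Notation I := (unit_interval R).

Definition conj_path (x y : X) (c : {path I from x to y in X})
    (l : {path I from y to y in X}) : {path I from x to x in X} :=
  concat c (concat l (reverse c)).

Lemma path_homotopic_conj (x y : X) (c : {path I from x to y in X}) l l' :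
  path_homotopic l l' -> path_homotopic (conj_path c l) (conj_path c l').
Proof.
by move=> ll'; apply: path_homotopic_concatr; exact: path_homotopic_concatl.
Qed.

Definition pi1_change (x y : X) (c : {path I from x to y in X}) (a : pi1 R y) :
  pi1 R x := \pi_(pi1 R x) (conj_path c (repr a)).

Section Change.
Variables (x y : X) (c : {path I from x to y in X}).

Lemma pi1_changeE l :
  pi1_change c (\pi_(pi1 R y) l) = \pi_(pi1 R x) (conj_path c l).
Proof. by apply/pi1_eqP/path_homotopic_conj/pi1_eqP; rewrite reprK. Qed.

(** Reassociation brings the inner [reverse c] next to the following [c], and the two cancel. *)
Lemma pi1_changeM : {morph pi1_change c : a b / (a * b)%g}.
Proof.
move=> a b; rewrite -(reprK a) -(reprK b) [X in pi1_change c X]pi1_mulE.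
rewrite (pi1_changeE (concat _ _)) (pi1_changeE (repr a)).
rewrite (pi1_changeE (repr b)) [RHS]pi1_mulE; apply/esym/pi1_eqP.
apply: path_homotopic_trans; first exact: path_homotopic_concatA.
apply: path_homotopic_concatr.
apply: path_homotopic_trans; first exact: path_homotopic_concatA.
apply: path_homotopic_trans; last exact/path_homotopic_sym/path_homotopic_concatA.
apply: path_homotopic_concatr; exact: path_homotopic_concatVK.
Qed.

End Change.

Lemma pi1_changeK (x y : X) (c : {path I from x to y in X}) :
  cancel (pi1_change c) (pi1_change (reverse c)).
Proof.
move=> a; rewrite -(reprK a) (pi1_changeE c) pi1_changeE; apply/pi1_eqP.
apply: path_homotopic_trans.
  apply: path_homotopic_concatr; exact: path_homotopic_concatA.
apply: path_homotopic_trans; first exact: path_homotopic_concatVK.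
apply: path_homotopic_trans; first exact: path_homotopic_concatA.
apply: path_homotopic_trans (path_homotopic_concatp1 _).
apply: path_homotopic_concatr; exact: path_homotopic_concatpV.
Qed.

End ChangeOfBasePoint.

Section InducedMap.
Variables (R : realType) (X Y : topologicalType) (f : X -> Y).
Hypothesis cf : continuous f.
Local Notation I := (unit_interval R).

Section MapPath.
Variables (x y : X) (l : {path I from x to y in X}).

Lemma image_path_continuous : continuous (f \o l).
Proof. by move=> t; apply: continuous_comp; [exact: cts_fun | exact: cf]. Qed.

Lemma image_path_zero : (f \o l) zero = f x.
Proof. by rewrite /= path_zero. Qed.

Lemma image_path_one : (f \o l) one = f y.
Proof. by rewrite /= path_one. Qed.

Definition image_path : {path I from f x to f y in Y} :=
  mk_path image_path_continuous image_path_zero image_path_one.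

End MapPath.

Lemma path_homotopic_map (x y : X) (l l' : {path I from x to y in X}) :
  path_homotopic l l' -> path_homotopic (image_path l) (image_path l').
Proof.
move=> [H [cH Hl Hl' Hx Hy]]; exists (f \o H).
split=> [|t|t|s|s] /=; rewrite ?Hl ?Hl' ?Hx ?Hy //.
by move=> w; apply: continuous_comp; [exact: cH | exact: cf].
Qed.

(** An equality and not just a homotopy, because [f] passes through the case split of
    [concat_fun]. *)
Lemma image_path_concat (x y z : X) (l : {path I from x to y in X})
    (l' : {path I from y to z in X}) :
  image_path (concat l l') = concat (image_path l) (image_path l').
Proof.
apply/path_eqP => t; rewrite /image_path /concat /= /concat_fun /mk_path /=.
by case: ifP.
Qed.

Definition pi1_map (x : X) (a : pi1 R x) : pi1 R (f x) :=
  \pi_(pi1 R (f x)) (image_path (repr a)).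

Lemma pi1_mapE (x : X) l :
  pi1_map (\pi_(pi1 R x) l) = \pi_(pi1 R (f x)) (image_path l).
Proof. by apply/pi1_eqP/path_homotopic_map/pi1_eqP; rewrite reprK. Qed.

Lemma pi1_mapM (x : X) : {morph @pi1_map x : a b / (a * b)%g}.
Proof.
move=> a b; rewrite -(reprK a) -(reprK b) [X in pi1_map X]pi1_mulE !pi1_mapE.
by rewrite image_path_concat [RHS]pi1_mulE.
Qed.

End InducedMap.

(** * Fundamental groups of a space and of a retract of it up to homotopy *)

Section HomotopyRetract.
Variables (R : realType) (X Y : topologicalType) (h : Y -> X) (g : X -> Y).
Local Notation I := (unit_interval R).
Hypotheses (ch : continuous h) (cg : continuous g).
Variable F : Y * I -> Y.
Hypotheses (cF : continuous F) (F0 : forall y, F (y, zero) = y).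
Hypothesis F1 : forall y, F (y, one) = g (h y).

Lemma track_continuous y : continuous (fun t : I => F (y, t)).
Proof.
move=> t; apply: (@continuous_comp _ _ _ (fun t : I => (y, t)) F); last exact: cF.
by apply: continuous_pair; [exact: cst_continuous | move=> ?; exact: cvg_id].
Qed.

Definition track y : {path I from y to g (h y) in Y} :=
  mk_path (@track_continuous y) (F0 y) (F1 y).

(** The square [F (l s, t)] has [l] and its image under [g \o h] as opposite sides, and [track y] as
    both other sides. The two concatenations are the two ways round its boundary. *)
Lemma track_naturality y (l : {path I from y to y in Y}) :
  path_homotopic (concat l (track y))
                 (concat (track y) (image_path cg (image_path ch l))).
Proof.
have half_gt (t : I) : 2^-1 < ival t -> 1 <= 2 * ival t by lra.
have half_le (t : I) : ival t <= 2^-1 -> 2 * ival t - 1 <= 0 by lra.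
(* [fast] crosses the interval in the first half of the time and then waits at [one]; [late] waits
   at [zero] and crosses in the second half. The waiting is done by [clamp]. *)
pose fast (t : I) : I := clamp (2 * ival t).
pose late (t : I) : I := clamp (2 * ival t - 1).
have [fast0 late0] : fast zero = zero /\ late zero = zero.
  by split; apply: clamp_le0; rewrite ival0; lra.
have [fast1 late1] : fast one = one /\ late one = one.
  by split; apply: clamp_ge1; rewrite ival1; lra.
have cfast : continuous fast.
  apply: (@continuous_clamp_comp _ _ _ _ id) => [|?]; last exact: cvg_id.
  rewrite (_ : (fun y => _) = (fun y => 2 * ival y + 0)).
    by apply: continuous_affine; exact: continuous_ival.
  by apply/funext => t; rewrite addr0.
have clate : continuous late.
  apply: (@continuous_clamp_comp _ _ _ _ id) => [|?]; last exact: cvg_id.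
  by apply: continuous_affine; exact: continuous_ival.
apply: (@path_homotopic_square _ _ _ _ _ _ (fun w => F (l w.1, w.2))
  (fun t => (fast t, late t)) (fun t => (late t, fast t))) => /=.
- move=> w; apply: (@continuous_comp _ _ _ (fun w : I * I => (l w.1, w.2)) F).
    apply: continuous_pair => z; last exact: cvg_snd.
    by apply: continuous_comp; [exact: cvg_fst | exact: cts_fun].
  exact: cF.
- exact: continuous_pair.
- exact: continuous_pair.
- by rewrite fast0 late0.
- by rewrite fast1 late1.
- move=> t; rewrite /concat /= /concat_fun /fast /late.
  case: (leP (ival t) 2^-1) => t2.
    by rewrite [X in (_, X)]clamp_le0 ?F0 //; exact: half_le.
  by rewrite [X in l X]clamp_ge1 ?path_one //; exact: half_gt.
- move=> t; rewrite /concat /= /concat_fun /fast /late.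
  case: (leP (ival t) 2^-1) => t2.
    by rewrite [X in l X]clamp_le0 ?path_zero //; exact: half_le.
  by rewrite [X in (_, X)]clamp_ge1 ?F1 //; exact: half_gt.
Qed.

Lemma pi1_change_track y :
  cancel (@pi1_map R _ _ _ cg (h y) \o @pi1_map R _ _ _ ch y)
         (pi1_change (track y)).
Proof.
move=> a; rewrite -(reprK a) /= (pi1_mapE ch) pi1_mapE pi1_changeE; apply/pi1_eqP.
apply: path_homotopic_trans; first exact/path_homotopic_sym/path_homotopic_concatA.
apply: path_homotopic_trans.
  apply: path_homotopic_concatl; exact/path_homotopic_sym/track_naturality.
apply: path_homotopic_trans; first exact: path_homotopic_concatA.
apply: path_homotopic_trans (path_homotopic_concatp1 _).
apply: path_homotopic_concatr; exact: path_homotopic_concatpV.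
Qed.

(** The section is induced by [h] and the retraction by [g]. Base points are corrected along [c],
    and along [track y] because [F] may move [y]. *)
Lemma pi1_retract (x : X) (y : Y) (c : {path I from x to h y in X}) :
  group_retract (pi1 R y) (pi1 R x).
Proof.
exists (pi1_change c \o @pi1_map R _ _ _ ch y).
exists (pi1_change (track y) \o @pi1_map R _ _ _ cg (h y) \o
        pi1_change (reverse c)).
split=> [a b|a b|a] /=; rewrite ?(pi1_mapM, pi1_changeM) //.
by rewrite pi1_changeK; exact: pi1_change_track.
Qed.

End HomotopyRetract.

(** * Isotopies of configuration spaces *)

Section UnorderedConfigurations.
Variable m : nat.

Section Space.
Variable M : topologicalType.
Local Notation C := (config m M).
Local Notation Q := (quotient_topology {eq_quot (config_equiv m M)}).

Definition mk_config (y : 'I_m -> M) (y_inj : injective y) : C :=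
  exist _ (y : prod_topology (fun _ : 'I_m => M)) (mem_set y_inj).

Definition uconf (c : C) : uconfig m M := \pi_Q c.

Lemma config_inj (c : C) : injective (\val c).
Proof. exact: set_mem (valP c). Qed.

Lemma uconf_surj (u : uconfig m M) : exists c, u = uconf c.
Proof. by exists (repr (u : Q)); rewrite /uconf reprK. Qed.

Lemma uconf_eq (c c' : C) (s : 'S_m) :
  (forall i, \val c' i = \val c (s i)) -> uconf c = uconf c'.
Proof. by move=> cc'; apply/eqmodP/asboolP; exists s. Qed.

Lemma uconf_eqE (c c' : C) : uconf c = uconf c' ->
  exists s : 'S_m, forall i, \val c' i = \val c (s i).
Proof. by move=> /eqmodP/asboolP. Qed.

(** The topology of [config] is initial for the inclusion in the product, and that of the product is
    the supremum of the initial topologies of the coordinates. *)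
Lemma continuous_to_config (Z : topologicalType) (f : Z -> C) :
  (forall i, continuous (fun z => \val (f z) i)) -> continuous f.
Proof.
move=> cf; apply: continuous_comp_initial => z.
apply/cvg_sup => i; move: z.
apply/(@continuousP _ (initial_topology (fun y : 'I_m -> M => y i))) => A [B oB <-].
by move/continuousP: (cf i) => /(_ _ oB).
Qed.

Lemma continuous_config_coord i : continuous (fun c : C => \val c i).
Proof.
move=> c; apply: (@continuous_comp _ _ _ (\val : C -> prod_topology _)
  (fun y : prod_topology (fun _ : 'I_m => M) => y i)).
  exact: initial_continuous.
exact: proj_continuous.
Qed.

Lemma uconf_continuous : continuous uconf.
Proof. exact: pi_continuous. Qed.

(** The saturation of [U] is the union of its translates under the symmetric group. *)
Lemma uconf_open (U : set C) : open U -> open (uconf @` U).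
Proof.
move=> oU.
pose act (s : 'S_m) (c : C) : C :=
  mk_config (inj_comp (@config_inj c) (@perm_inj _ s)).
have cact s : continuous (act s).
  by apply: continuous_to_config => i; exact: continuous_config_coord.
(* Openness in the quotient means openness of the preimage, and this union is the preimage of the
   image of [U]. *)
suff : open (\bigcup_(s in [set: 'S_m]) (act s @^-1` U)).
  congr open; apply/seteqP; split=> [c [s _ Uc]|c [c' Uc' /uconf_eqE[s sE]]].
    exists (act s c) => //; apply: (@uconf_eq _ _ s^-1%g) => i /=.
    by rewrite permKV.
  exists s^-1%g => //; rewrite /preimage /= (_ : act _ _ = c') //.
  by apply: val_inj; apply/funext => i; rewrite /= sE permKV.
apply: bigcup_open => s _; apply: open_comp => // c _; exact: cact.
Qed.

End Space.

Section Isotopy.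
Variables (R : realType) (M N : topologicalType).
Local Notation I := (unit_interval R).
Variable F : M * I -> N.
Hypotheses (cF : continuous F) (F_inj : forall t, injective (fun x => F (x, t))).

Definition config_isotopy (w : config m M * I) : config m N :=
  mk_config (inj_comp (@F_inj w.2) (@config_inj _ w.1)).

Definition uconfig_isotopy (w : uconfig m M * I) : uconfig m N :=
  uconf (config_isotopy
    (repr (w.1 : quotient_topology {eq_quot (config_equiv m M)}), w.2)).

(** Independence of the representative chosen by [repr]: a permutation relating two representatives
    also relates their images, since [F] acts point by point. *)
Lemma uconfig_isotopyE c t :
  uconfig_isotopy (uconf c, t) = uconf (config_isotopy (c, t)).
Proof.
rewrite /uconfig_isotopy /=; set c' := repr _.
have /uconf_eqE[s sE] : uconf c = uconf c' by rewrite /uconf reprK.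
by apply/esym/(@uconf_eq _ _ _ s) => i; rewrite /= sE.
Qed.

Lemma config_isotopy_continuous : continuous config_isotopy.
Proof.
apply: continuous_to_config => i w.
apply: (@continuous_comp _ _ _
  (fun w : config m M * I => (\val w.1 i, w.2)) F); last exact: cF.
apply: continuous_pair => z; last exact: cvg_snd.
apply: (@continuous_comp _ _ _ fst (fun c : config m M => \val c i)).
  exact: cvg_fst.
exact: continuous_config_coord.
Qed.

(** The source is the product of a quotient with [I], so the universal property of the quotient does
    not apply directly. Instead the open map [uconf] sends product neighbourhoods upstairs to
    product neighbourhoods. *)
Lemma uconfig_isotopy_continuous : continuous uconfig_isotopy.
Proof.
move=> [u t] V /=; have [c ->] := uconf_surj u.
rewrite uconfig_isotopyE => nV.
have : nbhs (c, t) ((uconf (M := N) \o config_isotopy) @^-1` V).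
  apply: (@continuous_comp _ _ _ config_isotopy (@uconf N)) => //.
    exact: config_isotopy_continuous.
  exact: uconf_continuous.
move=> [[A B] /= [nA nB] AB].
(* [A] is a neighbourhood that need not be open, hence the interior. *)
exists (@uconf M @` A°, B) => /=.
  split=> //; apply: (@open_nbhs_nbhs (uconfig m M)); split; last by exists c.
  by apply: uconf_open; exact: open_interior.
move=> [v s] /= [[c' Ac' <-] Bs]; rewrite uconfig_isotopyE.
by apply: (AB (c', s)); split=> //=; exact: interior_subset.
Qed.

End Isotopy.

Section InducedConfigMap.
Variables (M N : topologicalType) (f : M -> N).
Hypotheses (cf : continuous f) (f_inj : injective f).

Definition config_map (c : config m M) : config m N :=
  mk_config (inj_comp f_inj (@config_inj _ c)).

Definition uconfig_map (u : uconfig m M) : uconfig m N :=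
  uconf (config_map (repr (u : quotient_topology {eq_quot (config_equiv m M)}))).

Lemma uconfig_mapE c : uconfig_map (uconf c) = uconf (config_map c).
Proof.
rewrite /uconfig_map; set c' := repr _.
have /uconf_eqE[s sE] : uconf c = uconf c' by rewrite /uconf reprK.
by apply/esym/(@uconf_eq _ _ _ s) => i; rewrite /= sE.
Qed.

Lemma uconfig_map_continuous : continuous uconfig_map.
Proof.
apply/quotient_continuous.
rewrite (_ : _ \o _ = @uconf N \o config_map); last first.
  by apply/funext => c; exact: uconfig_mapE.
move=> c; apply: continuous_comp; last exact: uconf_continuous.
move: c; apply: continuous_to_config => i c.
apply: (@continuous_comp _ _ _ (fun c : config m M => \val c i) f).
  exact: continuous_config_coord.
exact: cf.
Qed.

End InducedConfigMap.

(** Injective maps keep distinct points distinct, so [h], [g] and each stage of [F] act on unordered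
    configurations, which reduces the claim to [pi1_retract]. *)
Lemma braid_group_retract (R : realType) (M N : topologicalType) (h : N -> M)
    (g : M -> N) (F : N * unit_interval R -> N) (h_inj : injective h)
    (b : uconfig m M) (d : uconfig m N)
    (c : {path (unit_interval R) from b to uconfig_map h_inj d}) :
  continuous h -> continuous g -> continuous F ->
  injective g -> (forall t, injective (fun x => F (x, t))) ->
  (forall x, F (x, zero) = x) -> (forall x, F (x, one) = g (h x)) ->
  group_retract (braid_group R d) (braid_group R b).
Proof.
move=> ch cg cF g_inj F_inj F0 F1.
apply: (@pi1_retract _ _ _ (uconfig_map h_inj) (uconfig_map g_inj) _ _
  (uconfig_isotopy F_inj)) c => [||||u].
- exact: uconfig_map_continuous.
- exact: uconfig_map_continuous.
- exact: uconfig_isotopy_continuous.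
- move=> u; have [c ->] := uconf_surj u; rewrite uconfig_isotopyE.
  by congr uconf; apply: val_inj; apply/funext => i /=.
- have [c ->] := uconf_surj u; rewrite uconfig_isotopyE !uconfig_mapE.
  by congr uconf; apply: val_inj; apply/funext => i /=.
Qed.

End UnorderedConfigurations.

(** * Stereographic projection *)

Section EuclideanSpace.
Variable R : realType.

Definition dot n (u v : 'rV[R]_n) : R := \sum_i u 0 i * v 0 i.

Section Dot.
Variable n : nat.
Implicit Types u v w : 'rV[R]_n.

Lemma mulmx_tr_dot u v : u *m v^T = (dot u v)%:M.
Proof.
by rewrite [LHS]mx11_scalar mxE; congr (_%:M); apply: eq_bigr => i _; rewrite mxE.
Qed.

Lemma dotE u v : dot u v = (u *m v^T) 0 0.
Proof. by rewrite mulmx_tr_dot mxE mulr1n. Qed.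

Lemma dotC u v : dot u v = dot v u.
Proof. by apply: eq_bigr => i _; rewrite mulrC. Qed.

Lemma dotDl u v w : dot (u + v) w = dot u w + dot v w.
Proof. by rewrite !dotE mulmxDl mxE. Qed.

Lemma dotZl a u v : dot (a *: u) v = a * dot u v.
Proof. by rewrite !dotE -scalemxAl mxE. Qed.

Lemma dotNl u v : dot (- u) v = - dot u v.
Proof. by rewrite -scaleN1r dotZl mulN1r. Qed.

Lemma dotDr u v w : dot w (u + v) = dot w u + dot w v.
Proof. by rewrite dotC dotDl !(dotC w). Qed.

Lemma dotZr a u v : dot u (a *: v) = a * dot u v.
Proof. by rewrite dotC dotZl dotC. Qed.

Lemma dotNr u v : dot u (- v) = - dot u v.
Proof. by rewrite dotC dotNl dotC. Qed.

Lemma dot_ge0 u : 0 <= dot u u.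
Proof. by apply: sumr_ge0 => i _; rewrite -expr2 sqr_ge0. Qed.

Lemma dot_eq0 u : dot u u = 0 -> u = 0.
Proof.
move=> u0; apply/rowP => i; rewrite mxE.
have /psumr_eq0P : forall j, true -> 0 <= u 0 j * u 0 j.
  by move=> j _; rewrite -expr2 sqr_ge0.
by move=> /(_ u0 i isT) /eqP; rewrite mulf_eq0 orbb => /eqP.
Qed.

Lemma sum_sqr_dot u : \sum_i u 0 i ^+ 2 = dot u u.
Proof. by apply: eq_bigr => i _; rewrite expr2. Qed.

(* The reflection in the hyperplane orthogonal to [x - y]. *)
Lemma householder x y : dot x x = dot y y ->
  exists2 A : 'M[R]_n, A *m A^T = 1%:M & y *m A = x.
Proof.
move=> xxyy; have [xy|xNy] := eqVneq (x - y) 0.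
  exists 1%:M; first by rewrite trmx1 mulmx1.
  by rewrite mulmx1 -(subrK y x) xy add0r.
set u := x - y in xNy *.
have uu0 : dot u u != 0 by apply: contraNneq xNy => /dot_eq0 ->.
pose k := 2 / dot u u.
have kuu : k * dot u u = 2 by rewrite divfK.
pose S := u^T *m u.
have ST : S^T = S by rewrite trmx_mul trmxK.
have S2 : S *m S = dot u u *: S.
  by rewrite /S mulmxA -(mulmxA _ u) mulmx_tr_dot mul_mx_scalar -scalemxAl.
exists (1%:M - k *: S).
  have -> : (1%:M - k *: S)^T = 1%:M - k *: S.
    by rewrite linearB /= tr_scalar_mx linearZ /= ST.
  rewrite mulmxBl mul1mx mulmxBr mulmx1 -scalemxAl -scalemxAr S2 !scalerA.
  rewrite -mulrA kuu -scalerBl -addrA -opprD -scalerDl.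
  by rewrite (_ : k + (k - k * 2) = 0) ?scale0r ?subr0 //; ring.
rewrite mulmxBr mulmx1 -scalemxAr mulmxA mulmx_tr_dot mul_scalar_mx scalerA.
(* Since [x] and [y] have the same norm, [dot u u] equals [-2 * dot y u]; so the reflection adds
   exactly [u] to [y]. *)
have -> : k * dot y u = -1.
  apply: (mulfI uu0); rewrite mulrA (mulrC _ k) kuu.
  by rewrite /u !(dotDl, dotDr, dotNl, dotNr) xxyy (dotC x y); ring.
by rewrite scaleN1r opprK addrC subrK.
Qed.

End Dot.

(** A reflection taking the first basis vector to [x] is an orthogonal matrix with first row [x];
    its other rows form [B]. The last identity says that [B^T *m B] is the orthogonal projection
    along [x]. *)
Lemma orthonormal_frame n (x : 'rV[R]_n.+1) : dot x x = 1 ->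
  exists B : 'M[R]_(n, n.+1),
    [/\ B *m B^T = 1%:M, x *m B^T = 0 & B^T *m B = 1%:M - x^T *m x].
Proof.
move=> xx; pose e : 'rV[R]_n.+1 := delta_mx 0 0.
have ee : dot e e = 1.
  rewrite /dot (bigD1 0) //= big1 ?addr0 ?mxE ?mulr1 //.
  by move=> i /negbTE i0; rewrite mxE i0 andbF mul0r.
have [A AA eA] := @householder _ x e (etrans xx (esym ee)).
pose B : 'M[R]_(n, n.+1) := @dsubmx _ 1 n n.+1 A.
have xA : @usubmx _ 1 n n.+1 A = x.
  rewrite -eA -rowE; apply/rowP => j; rewrite !mxE.
  by congr (A _ j); apply: val_inj.
have AE : A = col_mx x B by rewrite -xA vsubmxK.
have AAt : (col_mx x B : 'M[R]_(1 + n, n.+1)) *m (col_mx x B)^T = 1%:M.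
  by rewrite -AE.
have AtA : (col_mx x B : 'M[R]_(1 + n, n.+1))^T *m col_mx x B = 1%:M.
  by rewrite -AE; apply: mulmx1C.
exists B; move: AAt AtA; rewrite tr_col_mx mul_col_row mul_row_col.
rewrite scalar_mx_block => /eq_block_mx[_ xB _ ->] <-; split=> //.
by rewrite [X in X - _]addrC addrK.
Qed.

End EuclideanSpace.

(** * Continuity of expressions with vector values *)

Section Continuity.
Variables (R : realType) (T : topologicalType).

Lemma continuous_funD (V : normedModType R) (f g : T -> V) :
  continuous f -> continuous g -> continuous (fun t => f t + g t).
Proof. by move=> cf cg t; apply: cvgD; [exact: cf | exact: cg]. Qed.

Lemma continuous_funZ (V : normedModType R) (k : T -> R) (f : T -> V) :
  continuous k -> continuous f -> continuous (fun t => k t *: f t).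
Proof. by move=> ck cf t; apply: cvgZ; [exact: ck | exact: cf]. Qed.

Lemma continuous_funM (f g : T -> R) :
  continuous f -> continuous g -> continuous (fun t => f t * g t).
Proof. by move=> cf cg t; apply: cvgM; [exact: cf | exact: cg]. Qed.

Lemma continuous_funV (f : T -> R) :
  continuous f -> (forall t, f t != 0) -> continuous (fun t => (f t)^-1).
Proof. by move=> cf f0 t; apply: cvgV; [exact: f0 | exact: cf]. Qed.

Lemma continuous_sum n (V : normedModType R) (f : 'I_n -> T -> V) :
  (forall i, continuous (f i)) -> continuous (fun t => \sum_i f i t).
Proof.
move=> cf; suff cs (s : seq 'I_n) : continuous (fun t => \sum_(i <- s) f i t).
  exact: cs.
elim: s => [|i s IHs].
  rewrite (_ : (fun t => _) = cst 0); first exact: cst_continuous.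
  by apply/funext => t; rewrite big_nil.
rewrite (_ : (fun t => _) = (fun t => f i t + \sum_(j <- s) f j t)).
  exact: continuous_funD.
by apply/funext => t; rewrite big_cons.
Qed.

Lemma continuous_mxcoord m n (f : T -> 'M[R]_(m, n)) i j :
  continuous f -> continuous (fun t => f t i j).
Proof.
move=> cf t; apply: (@continuous_comp _ _ _ f (fun A => A i j)); first exact: cf.
exact: coord_continuous.
Qed.

Lemma continuous_mulmx n p (A : 'M[R]_(n, p)) (f : T -> 'rV[R]_n) :
  continuous f -> continuous (fun t => f t *m A).
Proof.
move=> cf; rewrite (_ : (fun t => _) = (fun t => \sum_i f t 0 i *: row i A)).
  apply: continuous_sum => i; apply: continuous_funZ; last exact: cst_continuous.
  exact: continuous_mxcoord.
by apply/funext => t; rewrite mulmx_sum_row.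
Qed.

Lemma continuous_dot n (f g : T -> 'rV[R]_n) :
  continuous f -> continuous g -> continuous (fun t => dot (f t) (g t)).
Proof.
move=> cf cg; apply: (@continuous_sum _ R^o) => i.
by apply: continuous_funM; exact: continuous_mxcoord.
Qed.

Lemma continuous_subtype (X : topologicalType) (A : set X) (f : T -> set_type A) :
  continuous (fun t => \val (f t)) -> continuous f.
Proof. exact: continuous_comp_initial. Qed.

End Continuity.

Section Stereographic.
Variables (R : realType) (n : nat) (x : 'rV[R]_n.+1) (B : 'M[R]_(n, n.+1)).
Hypotheses (xx : dot x x = 1) (BBt : B *m B^T = 1%:M) (xBt : x *m B^T = 0).
Hypothesis BtB : B^T *m B = 1%:M - x^T *m x.

(* Projection from [x] onto the hyperplane orthogonal to [x], where [B] gives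
   coordinates; at [x] itself it takes the junk value [0]. *)
Definition stereo (v : 'rV[R]_n.+1) : 'rV[R]_n := (1 - dot v x)^-1 *: (v *m B^T).

(** The usual inverse (2u, |u|^2 - 1) / (|u|^2 + 1), written in the frame of the rows of [B] and the
    pole [x]. *)
Definition stereo_inv (u : 'rV[R]_n) : 'rV[R]_n.+1 :=
  (1 + dot u u)^-1 *: (2 *: (u *m B) + (dot u u - 1) *: x).

Lemma stereo_inv_den_neq0 (u : 'rV[R]_n) : 1 + dot u u != 0.
Proof. by rewrite gt_eqF // ltr_pwDl // dot_ge0. Qed.

Lemma dot_mulB (u : 'rV[R]_n) v : dot (u *m B) v = dot u (v *m B^T).
Proof. by rewrite !dotE trmx_mul trmxK mulmxA. Qed.

Lemma dot_stereo_inv u : dot (stereo_inv u) x = (dot u u - 1) / (1 + dot u u).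
Proof.
rewrite /stereo_inv dotZl dotDl !dotZl dot_mulB xBt xx.
by rewrite [dot u 0]dotE trmx0 mulmx0 mxE mulr0 add0r mulr1 mulrC.
Qed.

Lemma stereo_inv_sphere u : dot (stereo_inv u) (stereo_inv u) = 1.
Proof.
rewrite {2}/stereo_inv dotZr dotDr !dotZr dot_stereo_inv.
rewrite /stereo_inv dotZl dotDl !dotZl !dot_mulB -mulmxA BBt mulmx1.
rewrite dotC dot_mulB xBt [dot u 0]dotE trmx0 mulmx0 mxE mulr0 addr0.
by field; exact: stereo_inv_den_neq0.
Qed.

(** The coordinate along [x] falls short of 1 by 2 / (1 + |u|^2). *)
Lemma stereo_inv_neq u : stereo_inv u <> x.
Proof.
move=> /(congr1 (fun v => dot v x)); rewrite dot_stereo_inv xx => /eqP.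
rewrite eq_sym -subr_eq0 (_ : 1 - _ = 2 / (1 + dot u u)).
  by rewrite mulf_eq0 invr_eq0 (negbTE (stereo_inv_den_neq0 u)) pnatr_eq0.
by field; exact: stereo_inv_den_neq0.
Qed.

Lemma stereo_invK : cancel stereo_inv stereo.
Proof.
move=> u; rewrite /stereo dot_stereo_inv /stereo_inv -scalemxAl mulmxDl.
rewrite -!scalemxAl xBt scaler0 addr0 -mulmxA BBt mulmx1 !scalerA.
rewrite -[RHS]scale1r; congr (_ *: _).
have N0 := stereo_inv_den_neq0 u.
by field; rewrite N0 (_ : _ - _ = 2) ?pnatr_eq0 //; ring.
Qed.

(** For unit vectors |v - x|^2 = 2 (1 - v.x). *)
Lemma sphere_dot_neq1 v : dot v v = 1 -> v <> x -> 1 - dot v x != 0.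
Proof.
move=> vv vx; apply/eqP => v1; apply: vx; apply/eqP; rewrite -subr_eq0; apply/eqP.
apply: dot_eq0; rewrite !(dotDl, dotDr, dotNl, dotNr) vv xx (dotC x v); lra.
Qed.

Lemma stereoK v : dot v v = 1 -> v <> x -> stereo_inv (stereo v) = v.
Proof.
move=> vv vx; have t1 := sphere_dot_neq1 vv vx; set t := dot v x in t1.
(* The projection of [v] orthogonal to [x] has squared norm 1 - t^2, which is divided by (1 -
   t)^2. *)
have uu : dot (stereo v) (stereo v) = (1 + t) / (1 - t).
  rewrite /stereo dotZl dotZr -dot_mulB -mulmxA BtB mulmxBr mulmx1.
  rewrite mulmxA mulmx_tr_dot mul_scalar_mx dotDl dotNl dotZl vv (dotC x) -/t.
  by field.
rewrite /stereo_inv uu /stereo -scalemxAl -mulmxA BtB mulmxBr mulmx1.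
rewrite mulmxA mulmx_tr_dot mul_scalar_mx -/t.
have -> : (1 + (1 + t) / (1 - t))^-1 = (1 - t) / 2.
  field; rewrite t1 /= (_ : _ + _ = 2) ?pnatr_eq0 //; ring.
have -> : (1 + t) / (1 - t) - 1 = 2 * t / (1 - t) by field.
rewrite scalerDr !scalerA (_ : _ / 2 * _ = 1); last by field.
by rewrite (_ : _ / 2 * _ = t) ?scale1r ?subrK //; field.
Qed.

Lemma continuous_stereo_inv (T : topologicalType) (f : T -> 'rV[R]_n) :
  continuous f -> continuous (fun t => stereo_inv (f t)).
Proof.
move=> cf; have cN := continuous_dot cf cf.
apply: continuous_funZ.
  apply: continuous_funV => [|t]; last exact: stereo_inv_den_neq0.
  by apply: (@continuous_funD _ _ R^o); first exact: cst_continuous.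
apply: continuous_funD; apply: continuous_funZ; try exact: cst_continuous.
  exact: continuous_mulmx.
by apply: (@continuous_funD _ _ R^o); last exact: cst_continuous.
Qed.

Lemma continuous_stereo (T : topologicalType) (f : T -> 'rV[R]_n.+1) :
  continuous f -> (forall t, dot (f t) (f t) = 1) -> (forall t, f t <> x) ->
  continuous (fun t => stereo (f t)).
Proof.
move=> cf f1 fx; apply: continuous_funZ; last exact: continuous_mulmx.
apply: continuous_funV => [|t]; last exact: sphere_dot_neq1.
have : continuous (fun t => 1 + -1 * dot (f t) x).
  apply: (@continuous_funD _ _ R^o); first exact: cst_continuous.
  apply: continuous_funM; first exact: cst_continuous.
  by apply: continuous_dot => //; exact: cst_continuous.
by under eq_fun do rewrite mulN1r.
Qed.

End Stereographic.

(** * Embeddings of the disc *)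

Section Squeeze.
Variables (R : realType) (n : nat).
Implicit Types (a : R) (u v w : 'rV[R]_n).

(** For [a > 0] this maps the whole space radially onto the open ball of radius 1 / sqrt a; for
    [a = 0] it is the identity. *)
Definition squeeze a u : 'rV[R]_n := (Num.sqrt (1 + a * dot u u))^-1 *: u.

Lemma squeeze_den_gt0 a u : 0 <= a -> 0 < 1 + a * dot u u.
Proof. by move=> a0; rewrite ltr_pwDl // mulr_ge0 // dot_ge0. Qed.

Lemma squeeze0 u : squeeze 0 u = u.
Proof. by rewrite /squeeze mul0r addr0 sqrtr1 invr1 scale1r. Qed.

Lemma dot_squeeze a u : 0 <= a ->
  dot (squeeze a u) (squeeze a u) = dot u u / (1 + a * dot u u).
Proof.
move=> a0; rewrite dotZl dotZr mulrA -expr2 exprVn sqr_sqrtr; first by rewrite mulrC.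
by apply: ltW; exact: squeeze_den_gt0.
Qed.

(** The norm of the image determines that of the vector, because N / (1 + a N) is injective in N >=
    0; then both scaling factors agree. *)
Lemma squeeze_inj a : 0 <= a -> injective (squeeze a).
Proof.
move=> a0 u v uv.
have ud := squeeze_den_gt0 u a0; have vd := squeeze_den_gt0 v a0.
have uuvv : dot u u = dot v v.
  have := congr1 (fun x => dot x x) uv; rewrite /= !dot_squeeze //.
  move/eqP; rewrite eqr_div ?(gt_eqF ud) ?(gt_eqF vd) // => /eqP.
  by rewrite !mulrDr !mulr1 mulrCA => uv2; lra.
apply: (scalerI _ (etrans uv _)); last by rewrite /squeeze uuvv.
by rewrite invr_eq0 sqrtr_eq0 -ltNge.
Qed.

Lemma squeeze_le1 a u : 0 <= a -> dot u u <= 1 + a * dot u u ->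
  dot (squeeze a u) (squeeze a u) <= 1.
Proof.
by move=> a0 ua; rewrite dot_squeeze // ler_pdivrMr ?mul1r // squeeze_den_gt0.
Qed.

(* While the unit disc is pushed along [w], squeezing at this rate keeps it
   inside itself: with [K = 1 + 2 |w|^2] one has [|v + s w|^2 <= 1 + s K], and
   [(1 + s K) (1 - s K) <= 1]. *)
Lemma squeeze_translate_le1 v w (s : R) : dot v v <= 1 -> 0 <= s <= 1 ->
  let z := squeeze (s * (1 + 2 * dot w w)) (v + s *: w) in dot z z <= 1.
Proof.
move=> v1 /andP[s0 s1]; have w0 := dot_ge0 w.
set K := 1 + 2 * dot w w; have K0 : 0 <= K by rewrite /K; lra.
apply: squeeze_le1; first exact: mulr_ge0.
set N := dot _ _.
have NK : N <= 1 + s * K.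
  (* This bounds the cross term: 2 v.w <= |v|^2 + |w|^2. *)
  have := dot_ge0 (v - w); rewrite /N /K.
  rewrite !(dotDl, dotDr, dotNl, dotNr, dotZl, dotZr) (dotC w v).
  have sw : s * (s * dot w w) <= s * dot w w.
    by rewrite ler_piMl // mulr_ge0.
  have := dot_ge0 v; nra.
have N0 : 0 <= N by exact: dot_ge0.
have sK0 : 0 <= s * K by exact: mulr_ge0.
(* The goal is N <= 1 + s K N. It is clear if s K >= 1; otherwise multiply [NK] by 1 - s K. *)
by case: (lerP 1 (s * K)) => sK; nra.
Qed.

Lemma continuous_squeeze (T : topologicalType) (k : T -> R) (f : T -> 'rV[R]_n) :
  continuous k -> continuous f -> (forall t, 0 <= k t) ->
  continuous (fun t => squeeze (k t) (f t)).
Proof.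
move=> ck cf k0; apply: continuous_funZ => //; apply: continuous_funV => t.
  apply: (@continuous_comp _ _ _ (fun t => 1 + k t * dot (f t) (f t)) Num.sqrt).
    apply: (@continuous_funD _ _ R^o); first exact: cst_continuous.
    by apply: continuous_funM => //; exact: continuous_dot.
  exact: sqrt_continuous.
by rewrite sqrtr_eq0 -ltNge squeeze_den_gt0.
Qed.

End Squeeze.

(** * Linear forms separating finitely many points of the plane *)

Section GenericProjection.
Variable R : realType.

Lemma exists_notin (l : seq R) : exists s, s \notin l.
Proof.
exists (1 + \sum_(r <- l) `|r|); apply/negP => sl.
have : `|1 + \sum_(r <- l) `|r| | <= \sum_(r <- l) `|r|.
  rewrite [leRHS](big_rem _ sl) /= lerDl; exact: sumr_ge0.
by rewrite ger0_norm ?addr_ge0 ?sumr_ge0 // gerDr ler10.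
Qed.

Definition height (s : R) (z : 'rV[R]_2) : R := z 0 1 - s * z 0 0.

(** The direction of the level lines of [height s], normalized to have first coordinate 1. *)
Definition slanted (s : R) : 'rV[R]_2 := delta_mx 0 0 + s *: delta_mx 0 1.

Lemma slanted0 s : slanted s 0 0 = 1.
Proof. by rewrite !mxE /= mulr0 addr0. Qed.

Lemma heightD s y z : height s (y + z) = height s y + height s z.
Proof. by rewrite /height !mxE; ring. Qed.

Lemma heightZ s a z : height s (a *: z) = a * height s z.
Proof. by rewrite /height !mxE; ring. Qed.

Lemma height_slanted s : height s (slanted s) = 0.
Proof. by rewrite /height !mxE /=; ring. Qed.

Lemma row2P (y z : 'rV[R]_2) : y 0 0 = z 0 0 -> y 0 1 = z 0 1 -> y = z.
Proof.
move=> yz0 yz1; apply/rowP => -[[|[|i]] i2] //.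
  by rewrite (_ : Ordinal i2 = 0) //; exact: val_inj.
by rewrite (_ : Ordinal i2 = 1) //; exact: val_inj.
Qed.

(** Two distinct points have equal height only if [s] is the slope of the line through them, so it
    suffices to avoid finitely many slopes. *)
Lemma generic_height (l : seq 'rV[R]_2) :
  exists s, {in l &, injective (height s)}.
Proof.
(* Pairs with equal first coordinates contribute a quotient by 0, that is 0, which merely excludes
   one more slope. *)
have [s sl] := exists_notin
  [seq (y 0 1 - z 0 1) / (y 0 0 - z 0 0) |
     y : 'rV_2 <- l, z : 'rV_2 <- l].
exists s => y z yl zl yz; have yz1 : y 0 1 - z 0 1 = s * (y 0 0 - z 0 0).
  by move: yz; rewrite /height; lra.
have [yz0|yz0] := eqVneq (y 0 0 - z 0 0) 0.
  by apply: row2P; apply/eqP; rewrite -subr_eq0 ?yz1 yz0 ?mulr0.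
case/negP: sl; apply/allpairsP; exists (y, z); split=> //=.
by rewrite yz1 mulfK.
Qed.

(** The permutation is read off from sorting the indices by [k]; injectivity makes the order
    strict. *)
Lemma increasing_perm m (k : 'I_m -> R) : injective k ->
  exists s : 'S_m, forall i j : 'I_m, (i < j)%N -> k (s i) < k (s j).
Proof.
move=> k_inj; pose r := relpre k <=%R.
have [s sE] : exists s : 'S_m,
    sort r (ord_tuple m) = [tuple tnth (ord_tuple m) (s i) | i < m].
  by apply/tuple_permP; rewrite perm_sort.
exists s => i j ij; rewrite lt_neqAle.
have -> : k (s i) != k (s j).
  by apply: contraTneq ij => /k_inj /perm_inj ->; rewrite ltnn.
have : sorted r (sort r (ord_tuple m)).
  by apply: sort_sorted => a b; exact: le_total.
have r_trans : transitive r by move=> a b c; exact: le_trans.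
rewrite sE => /(sorted_ltn_nth r_trans i) /(_ i j).
rewrite !inE !size_tuple => /(_ (ltn_ord i) (ltn_ord j) ij).
by rewrite -!tnth_nth !tnth_mktuple !tnth_ord_tuple.
Qed.

End GenericProjection.

(** * Paths of configurations in the punctured plane *)

Section PuncturedPlane.
Variables (R : realType) (m : nat) (x : 'rV[R]_3) (B : 'M[R]_(2, 3)).
Hypotheses (xx : dot x x = 1) (BBt : B *m B^T = 1%:M) (xBt : x *m B^T = 0).
Hypothesis BtB : B^T *m B = 1%:M - x^T *m x.
Variables (A : set 'rV[R]_3) (p q : 'rV[R]_2).
Hypothesis stereo_inv_in : forall z, z <> p -> z <> q -> A (stereo_inv x B z).
Local Notation I := (unit_interval R).
Local Notation M := (set_type A).

Definition plane_point z (zp : z <> p) (zq : z <> q) : M :=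
  exist _ (stereo_inv x B z) (mem_set (stereo_inv_in zp zq)).

Lemma plane_braid_path (f : I -> 'I_m -> 'rV[R]_2) (c0 c1 : config m M) :
  (forall i, continuous (f^~ i)) -> (forall t, injective (f t)) ->
  (forall t i, f t i <> p) -> (forall t i, f t i <> q) ->
  (forall i, \val (\val c0 i) = stereo_inv x B (f zero i)) ->
  (forall i, \val (\val c1 i) = stereo_inv x B (f one i)) ->
  inhabited {path I from uconf c0 to uconf c1}.
Proof.
move=> cf f_inj fp fq c0E c1E.
have g_inj t : injective (fun i => plane_point (@fp t i) (@fq t i)).
  by move=> i j /(congr1 \val) /(can_inj (stereo_invK xx BBt xBt)) /f_inj.
pose g t : config m M := mk_config (@g_inj t).
have cg : continuous (@uconf m M \o g).
  move=> t; apply: continuous_comp; last exact: uconf_continuous.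
  move: t; apply: continuous_to_config => i.
  by apply: continuous_subtype; exact: continuous_stereo_inv.
have g0 : (@uconf m M \o g) zero = uconf c0.
  by congr uconf; apply: val_inj; apply/funext => i; apply: val_inj; rewrite c0E.
have g1 : (@uconf m M \o g) one = uconf c1.
  by congr uconf; apply: val_inj; apply/funext => i; apply: val_inj; rewrite c1E.
exact: (inhabits (mk_path cg g0 g1 : {path I from uconf c0 to uconf c1})).
Qed.

End PuncturedPlane.

(** Renumbering leaves the unordered configuration unchanged. The last clause transfers facts about
    the points of [c] to those of [c']. *)
Lemma increasing_config (R : realType) m (M : topologicalType) (k : M -> R)
    (c : config m M) : injective (k \o \val c) ->
  exists2 c' : config m M, uconf c = uconf c' &
    (forall i j : 'I_m, (i < j)%N -> k (\val c' i) < k (\val c' j)) /\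
    (forall i, exists j, \val c' i = \val c j).
Proof.
move=> /increasing_perm[s s_incr].
exists (mk_config (inj_comp (@config_inj _ _ c) (@perm_inj _ s))).
  by apply: (@uconf_eq _ _ _ _ s).
by split=> // i; exists (s i).
Qed.

Lemma increasing_inj (R : realType) m (k : 'I_m -> R) :
  (forall i j : 'I_m, (i < j)%N -> k i < k j) -> injective k.
Proof.
move=> k_incr i j kij; apply: val_inj; apply/eqP.
by case: ltngtP => // /k_incr; rewrite kij ltxx.
Qed.

Lemma convex_lt (R : realDomainType) (y z r1 r2 t : R) :
  y < r1 -> z < r2 -> 0 <= t <= 1 ->
  (1 - t) * y + t * z < (1 - t) * r1 + t * r2.
Proof.
(* Strictness comes from the first inequality when [t = 0] and from the second otherwise. *)
move=> yr1 zr2 /andP[t0 t1]; have [->|tN0] := eqVneq t 0; first by lra.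
have t_gt0 : 0 < t by rewrite lt_def tN0.
by rewrite ler_ltD ?ltr_pM2l // ler_wpM2l ?subr_ge0 // ltW.
Qed.

Lemma disc_coord0_ge (R : realType) (v : 'rV[R]_2) : dot v v <= 1 -> -1 <= v 0 0.
Proof.
by rewrite /dot !big_ord_recl big_ord0 /=; have := sqr_ge0 (v 0 (lift ord0 ord0)); nra.
Qed.

(** * The retract for the sphere without three points *)

Lemma braid_group_punctured_sphere_retract (R : realType) (m : nat)
    (x1 x2 x3 : 'rV[R]_3)
    (b : uconfig m (set_type (sphere2 R `\` [set x1; x2; x3])))
    (d : uconfig m (set_type (disc2 R))) :
  sphere2 R x1 -> sphere2 R x2 -> sphere2 R x3 ->
  x1 <> x2 -> x1 <> x3 ->
  group_retract (braid_group R d) (braid_group R b).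
Proof.
rewrite /sphere2 /= !sum_sqr_dot => xx1 xx2 xx3 x12 x13.
have [B [BBt xBt BtB]] := orthonormal_frame xx1.
set A := sphere2 R `\` _ in b *.
(* Seen from the pole [x1], the punctured sphere is the plane without [p] and [q]. *)
pose p := stereo x1 B x2; pose q := stereo x1 B x3.
have A1 (v : set_type A) : dot (\val v) (\val v) = 1.
  by have [] := set_mem (valP v); rewrite /sphere2 /= sum_sqr_dot.
have Ax (v : set_type A) : [/\ \val v <> x1, \val v <> x2 & \val v <> x3].
  have [_ /= nv] := set_mem (valP v).
  by split=> vx; apply: nv; rewrite vx; [left; left|left; right|right].
have Ainv z : z <> p -> z <> q -> A (stereo_inv x1 B z).
  move=> zp zq; split; first by rewrite /sphere2 /= sum_sqr_dot stereo_inv_sphere.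
  case=> [[|]|] /=; first exact: stereo_inv_neq.
    by move=> zx; apply: zp; rewrite /p -zx stereo_invK.
  by move=> zx; apply: zq; rewrite /q -zx stereo_invK.
pose pt (v : set_type A) : 'rV[R]_2 := stereo x1 B (\val v).
have ptK v : stereo_inv x1 B (pt v) = \val v.
  by have [v1 _ _] := Ax v; exact: (stereoK xx1 BtB (A1 v) v1).
have pt_inj : injective pt.
  by move=> v v' vv'; apply: val_inj; rewrite -ptK vv' ptK.
have ptp v : pt v <> p.
  have [_ v2 _] := Ax v; move=> vp; apply: v2.
  by rewrite -ptK vp (stereoK xx1 BtB xx2) //; exact: nesym.
have ptq v : pt v <> q.
  have [_ _ v3] := Ax v; move=> vq; apply: v3.
  by rewrite -ptK vq (stereoK xx1 BtB xx3) //; exact: nesym.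
have D1 (v : set_type (disc2 R)) : dot (\val v) (\val v) <= 1.
  by have := set_mem (valP v); rewrite /disc2 /= sum_sqr_dot.
have [b0 bE] := uconf_surj b; have [d0 dE] := uconf_surj d.
(* One list, because a single slope must serve for both numberings and for passing the punctures. *)
pose L := p :: q :: [seq pt (\val b0 i) | i <- enum 'I_m] ++
  [seq \val (\val d0 i) | i <- enum 'I_m].
have pL : p \in L by rewrite inE eqxx.
have qL : q \in L by rewrite !inE eqxx orbT.
have bL i : pt (\val b0 i) \in L.
  by rewrite !inE mem_cat (map_f (fun i => pt (\val b0 i))) ?mem_enum ?orbT.
have dL i : \val (\val d0 i) \in L.
  rewrite !inE mem_cat orbCA (map_f (fun i => \val (\val d0 i))) ?mem_enum //.
  by rewrite !orbT.
have [s sP] := generic_height L.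
have [b1 b01 [b1_incr b10]] : exists2 b1, uconf b0 = uconf b1 &
    (forall i j : 'I_m, (i < j)%N ->
      height s (pt (\val b1 i)) < height s (pt (\val b1 j))) /\
    (forall i, exists j, \val b1 i = \val b0 j).
  apply: (@increasing_config _ _ _ (height s \o pt)) => i j /= ij.
  apply: (@config_inj _ _ b0); exact/pt_inj/sP.
have [d1 d01 [d1_incr _]] : exists2 d1, uconf d0 = uconf d1 &
    (forall i j : 'I_m, (i < j)%N ->
      height s (\val (\val d1 i)) < height s (\val (\val d1 j))) /\
    (forall i, exists j, \val d1 i = \val d0 j).
  apply: (@increasing_config _ _ _
    (fun v : set_type (disc2 R) => height s (\val v))) => i j /= ij.
  apply: (@config_inj _ _ d0); exact/val_inj/sP.
have b1p i : height s (pt (\val b1 i)) <> height s p.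
  by have [j ->] := b10 i; move=> /sP => /(_ (bL j) pL) /ptp.
have b1q i : height s (pt (\val b1 i)) <> height s q.
  by have [j ->] := b10 i; move=> /sP => /(_ (bL j) qL) /ptq.
(* A shift of the first coordinate by [T] takes the points of [b1] and the whole disc beyond both
   punctures, with margin at least 1. *)
pose T := 2 + `|p 0 0| + `|q 0 0| + \sum_i `|pt (\val b1 i) 0 0|.
pose far r := p 0 0 < r + T /\ q 0 0 < r + T.
have farS r : - (1 + \sum_i `|pt (\val b1 i) 0 0|) <= r -> far r.
  rewrite /far /T; move: (\sum_i _) (p 0 0) (q 0 0) => S y z rS.
  have := ler_norm y; have := ler_norm z.
  have := normr_ge0 y; have := normr_ge0 z.
  clear -rS; lra.
have S0 : 0 <= \sum_i `|pt (\val b1 i) 0 0| by exact: sumr_ge0.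
have b1T i : far (pt (\val b1 i) 0 0).
  apply: farS; rewrite lerNl (le_trans (ler_norm _)) // normrN.
  by rewrite (bigD1 i) //= addrCA lerDl addr_ge0 // sumr_ge0.
have dT (v : set_type (disc2 R)) : far (\val v 0 0).
  apply: farS; apply: le_trans (disc_coord0_ge (D1 v)).
  by rewrite lerN2 lerDl.
(* Translation along [w] shifts the first coordinate by [T] and preserves heights. *)
pose w := T *: slanted s.
have w0 : w 0 0 = T by rewrite mxE slanted0 mulr1.
have hw : height s w = 0 by rewrite heightZ height_slanted mulr0.
have farP (z : 'rV[R]_2) : far (z 0 0) -> z + w <> p /\ z + w <> q.
  have zw0 : (z + w) 0 0 = z 0 0 + T by rewrite mxE w0.
  by rewrite /far -zw0 => -[zp zq]; split=> zw; [move: zp|move: zq];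
    rewrite zw ltxx.
pose h (v : set_type (disc2 R)) : set_type A :=
  plane_point Ainv (farP _ (dT v)).1 (farP _ (dT v)).2.
have h_inj : injective h.
  move=> v v' /(congr1 \val) /= /(can_inj (stereo_invK xx1 BBt xBt)) /addIr.
  by move=> vv'; apply: val_inj.
(* This rate serves twice: [K >= 1] squeezes the whole plane into the disc, and it is the rate of
   [squeeze_translate_le1], so that [F] ends at [g \o h]. *)
pose K := 1 + 2 * dot w w.
have K1 : 1 <= K by rewrite lerDl mulr_ge0 // dot_ge0.
have K0 : 0 <= K by exact: le_trans ler01 K1.
have gP v : squeeze K (pt v) \in disc2 R.
  apply/mem_set; rewrite /disc2 /= sum_sqr_dot; apply: squeeze_le1 => //.
  by rewrite (le_trans (ler_peMl (dot_ge0 _) K1)) // lerDr.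
pose g v : set_type (disc2 R) := exist (fun z => z \in disc2 R) _ (gP v).
have FP (z : set_type (disc2 R) * unit_interval R) :
    squeeze (ival z.2 * K) (\val z.1 + ival z.2 *: w) \in disc2 R.
  apply/mem_set; rewrite /disc2 /= sum_sqr_dot.
  exact: squeeze_translate_le1 (D1 _) (ival_itv _).
pose F z : set_type (disc2 R) := exist (fun z => z \in disc2 R) _ (FP z).
have iK0 (t : unit_interval R) : 0 <= ival t * K.
  by apply: mulr_ge0 => //; have /andP[] := ival_itv t.
have ci := @continuous_ival R.
have [c1] : inhabited {path (unit_interval R) from uconf b1 to uconfig_map h_inj d}.
  have moved_inj : injective (fun i => plane_point Ainv
      (farP _ (b1T i)).1 (farP _ (b1T i)).2).
    move=> i j /(congr1 \val) /= /(can_inj (stereo_invK xx1 BBt xBt)) /addIr.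
    by move=> /pt_inj /config_inj.
  have [c1] : inhabited {path (unit_interval R) from uconf b1
                         to uconf (mk_config moved_inj)}.
    (* First motion: the points slide along their level lines, none of which contains a puncture. *)
    apply: (@plane_braid_path _ _ _ _ xx1 BBt xBt _ _ _ Ainv
      (fun t i => pt (\val b1 i) + ival t *: w)) => [i|t i j|t i|t i|i|i].
    - apply: continuous_funD; first exact: cst_continuous.
      by apply: continuous_funZ => //; exact: cst_continuous.
    - by move=> /addIr /pt_inj /config_inj.
    - move=> /(congr1 (height s)); rewrite heightD (heightZ _ (ival t)) hw mulr0 addr0.
      exact: b1p.
    - move=> /(congr1 (height s)); rewrite heightD (heightZ _ (ival t)) hw mulr0 addr0.
      exact: b1q.
    - by rewrite ival0 scale0r addr0 ptK.
    - by rewrite ival1 scale1r.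
  have [c2] : inhabited {path (unit_interval R) from
      uconf (mk_config moved_inj) to uconfig_map h_inj d}.
    rewrite dE d01 uconfig_mapE.
    have farC (t : unit_interval R) i :
        far (((1 - ival t) *: pt (\val b1 i) + ival t *: \val (\val d1 i)) 0 0).
      have [bp bq] := b1T i; have [dp dq] := dT (\val d1 i).
      (* Each bound is written as a combination with the weights of the motion, to match
         [convex_lt]. *)
      have T_mix r : (1 - ival t) * (r - T) + ival t * (r - T) + T = r.
        by rewrite -mulrDl !subrK mul1r subrK.
      have mixE (y z : 'rV[R]_2) : ((1 - ival t) *: y + ival t *: z) 0 0 =
          (1 - ival t) * y 0 0 + ival t * z 0 0 by rewrite !mxE.
      rewrite /far mixE -[X in X < _ /\ _]T_mix -[X in _ /\ X < _]T_mix !ltrD2r.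
      by split; apply: convex_lt (ival_itv t); rewrite ltrBlDr.
    (* Second motion, beyond the punctures: straight lines preserve the strict order of heights, so
       the points never collide. *)
    apply: (@plane_braid_path _ _ _ _ xx1 BBt xBt _ _ _ Ainv
      (fun t i => ((1 - ival t) *: pt (\val b1 i) +
        ival t *: \val (\val d1 i)) + w)) => [i|t|t i|t i|i|i].
    - apply: continuous_funD; last exact: cst_continuous.
      apply: continuous_funD; apply: continuous_funZ => //; try exact: cst_continuous.
      have : continuous (fun t : unit_interval R => -1 * ival t + 1).
        exact: continuous_affine.
      by under eq_fun do rewrite mulN1r addrC.
    - apply: (@inj_compr _ _ _ (height s)); apply: increasing_inj => i j ij /=.
      rewrite !heightD !(heightZ _ (ival t)) !(heightZ _ (1 - _)) hw !addr0.
      apply: convex_lt (ival_itv t).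
        exact: b1_incr.
      exact: d1_incr.
    - exact: (farP _ (farC _ _)).1.
    - exact: (farP _ (farC _ _)).2.
    - by rewrite ival0 subr0 scale1r scale0r addr0.
    - by rewrite ival1 subrr scale1r scale0r add0r.
  exact: (inhabits (concat c1 c2)).
rewrite bE b01; apply: (@braid_group_retract _ _ _ _ h g F h_inj) c1 _ _ _ _ _ _ _.
- apply: continuous_subtype; apply: continuous_stereo_inv.
  apply: continuous_funD; last exact: cst_continuous.
  exact: initial_continuous.
- apply: continuous_subtype; apply: continuous_squeeze => //.
    exact: cst_continuous.
  apply: continuous_stereo => //; last by move=> v; have [] := Ax v.
  exact: initial_continuous.
- apply: continuous_subtype; apply: continuous_squeeze => //.
    apply: continuous_funM; last exact: cst_continuous.
    by move=> z; apply: continuous_comp; [exact: cvg_snd | exact: ci].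
  apply: continuous_funD.
    by move=> z; apply: continuous_comp; [exact: cvg_fst | exact: initial_continuous].
  apply: continuous_funZ; last exact: cst_continuous.
  by move=> z; apply: continuous_comp; [exact: cvg_snd | exact: ci].
- by move=> v v' /(congr1 \val) /= /(squeeze_inj K0) /pt_inj.
- move=> t v v' /(congr1 \val) /= /(squeeze_inj (iK0 t)) /addIr.
  by move=> vv'; apply: val_inj.
- by move=> v; apply: val_inj; rewrite /= ival0 mul0r squeeze0 scale0r addr0.
- move=> v; apply: val_inj; rewrite /= ival1 mul1r scale1r.
  by rewrite /pt /= stereo_invK.
Qed.

Theorem proposition61 (R : realType) (m : nat) (x1 x2 x3 : 'rV[R]_3)
    (b : uconfig m (set_type (sphere2 R `\` [set x1; x2; x3])))
    (d : uconfig m (set_type (disc2 R))) :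
  (2 <= m)%N ->
  sphere2 R x1 -> sphere2 R x2 -> sphere2 R x3 ->
  x1 <> x2 -> x1 <> x3 -> x2 <> x3 ->
  is_semidirect_by (braid_group R b) (braid_group R d) /\
  (forall i : nat, (1 <= i)%N ->
     is_semidirect_by (derived i (braid_group R b))
                      (derived i (braid_group R d))).
Proof.
move=> _ xx1 xx2 xx3 x12 x13 _.
have bd := braid_group_punctured_sphere_retract b d xx1 xx2 xx3 x12 x13.
split=> [|i _]; apply: retract_semidirect => //; exact: retract_derived.
Qed.
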